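(* Let $\alpha>1$, let $X_{\alpha}(t)$ be the pseudo-process governed by the Cauchy problem $\frac{\partial u}{\partial t}(x,t)={}_{x}D^{\alpha}_{1}u(x,t)$, $u(x,0)=\delta(x)$, and let $S_{\theta}(t)$ be a stable subordinator of exponent $\theta$, $0<\theta<1$, independent of $X_{\alpha}(t)$. If $\alpha\theta>1$, then for all $t>0$ and $x\in\mathbb{R}\setminus\{0\}$ $$\mathbb{P}(X_{\alpha}(S_{\theta}(t))\in dx)/dx=\frac{1}{\pi x}\,\mathbb{E}\left[e^{-b_{\alpha} x\,G_{\alpha\theta}(1/t)}\sin\left(a_{\alpha} x\,G_{\alpha\theta}(1/t)\right)\right],$$ where $G_{\gamma}(\tau)$ is a random variable with generalized gamma distribution having probability density function $$g_{\gamma}(y;\tau)=\gamma\frac{y^{\gamma-1}}{\tau}\exp\left(-\frac{y^{\gamma}}{\tau}\right),\qquad y,\gamma,\tau>0,$$ and $$a_{\alpha}=\cos\frac{\pi}{2\alpha},\qquad b_{\alpha}=\sin\frac{\pi}{2\alpha}.$$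
   Context: With $\mathcal{F}\{f\}(\gamma)=\int_{-\infty}^{+\infty}e^{i\gamma x}f(x)\,dx$, the Riesz-Feller operator ${}_xD^{\alpha}_{\theta}$ is defined by $\mathcal{F}\{{}_{x}D^{\alpha}_{\theta}f\}(\gamma)=-|\gamma|^{\alpha}e^{\frac{i\pi\theta}{2}\operatorname{sgn}(\gamma)}\mathcal{F}\{f\}(\gamma)$ (for $\theta=1$ the multiplier is $-i\operatorname{sgn}(\gamma)|\gamma|^\alpha$). The pseudo-density of $X_\alpha(t)$ is the (signed) fundamental solution of the Cauchy problem, namely $$u_{\alpha}(x,t)=\frac{1}{\pi}\int_0^{+\infty}\cos\left(\gamma x+t\gamma^{\alpha}\right)d\gamma,\qquad x\in\mathbb{R},\ t>0,$$ where the integral is a (conditionally convergent) improper integral. The stable subordinator $S_\theta(t)$ has characteristic function $\mathbb{E}[e^{i\gamma S_\theta(t)}]=e^{-t|\gamma|^{\theta}e^{-i\frac{\theta\pi}{2}\operatorname{sgn}\gamma}}$, $\gamma\in\mathbb{R}$; its probability density on $(0,\infty)$ is denoted by $h_\theta(s,t)$. The pseudo-density of the subordinated pseudo-process is by definition $$\mathbb{P}(X_{\alpha}(S_{\theta}(t))\in dx)/dx=\int_0^{+\infty}u_{\alpha}(x,s)\,h_\theta(s,t)\,ds.$$ *)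

(* Defs.v *)
From HB Require Import structures.
From mathcomp Require Import all_boot all_order all_algebra.
From mathcomp Require Import all_classical all_reals all_analysis.
From mathcomp Require Import complex.

Set Implicit Arguments.
Unset Strict Implicit.
Unset Printing Implicit Defensive.

Import Order.TTheory GRing.Theory Num.Theory numFieldNormedType.Exports.

Local Open Scope classical_set_scope.
Local Open Scope ring_scope.

(** ** Complex exponential and characteristic functions *)

Definition cexp (R : realType) (z : R[i]) : R[i] :=
  Complex (expR (complex.Re z) * cos (complex.Im z))
          (expR (complex.Re z) * sin (complex.Im z)).

(** The library integrates (extended) real-valued functions only, so the
    expectation of [exp (i gamma X)] is taken componentwise. *)
Definition char_fun (d : measure_display) (T : measurableType d) (R : realType)
    (P : probability T R) (X : {RV P >-> R}) (gamma : R) : R[i] :=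
  Complex (\int[P]_w cos (gamma * X w)) (\int[P]_w sin (gamma * X w)).

(** [f], restricted to the Borel set [D], is a probability density function of
    [X] with respect to the Lebesgue measure; in particular [X] lies in [D]
    almost surely.  Values of [f] outside [D] are irrelevant. *)
Definition is_pdf_on (d : measure_display) (T : measurableType d)
    (R : realType) (P : probability T R) (D : set R) (X : {RV P >-> R})
    (f : R -> R) : Prop :=
  [/\ measurable_fun D f,
      (forall y, D y -> 0 <= f y)
    & forall A : set R, measurable A ->
        distribution P X A
        = (\int[@lebesgue_measure R]_(y in A `&` D) (f y)%:E)%E].

(** ** Stable subordinators *)

(** Processes are indexed by all of [R], but only the times [0 <= t] matter. *)

Definition independent_increments (d : measure_display)
    (T : measurableType d) (R : realType) (P : probability T R)
    (S : R -> {RV P >-> R}) : Prop :=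
  forall (n : nat) (t : nat -> R) (A : nat -> set R),
    0 <= t 0%N ->
    (forall i, (i < n)%N -> t i <= t i.+1) ->
    (forall i, measurable (A i)) ->
    P (\bigcap_(i in [set i | (i < n)%N])
         [set w | A i (S (t i.+1) w - S (t i) w)])
    = (\prod_(i < n) P [set w | A i (S (t i.+1) w - S (t i) w)%R])%E.

Definition stationary_increments (d : measure_display)
    (T : measurableType d) (R : realType) (P : probability T R)
    (S : R -> {RV P >-> R}) : Prop :=
  forall (s t : R) (A : set R), 0 <= s -> 0 <= t -> measurable A ->
    P [set w | A (S (s + t) w - S s w)] = P [set w | A (S t w)].

Record is_subordinator (d : measure_display) (T : measurableType d)
    (R : realType) (P : probability T R) (S : R -> {RV P >-> R}) : Prop :=
  IsSubordinator {
    subordinator0 : {ae P, forall w, S 0 w = 0} ;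
    subordinator_nondecreasing :
      {ae P, forall w, forall s t : R, 0 <= s -> s <= t -> S s w <= S t w} ;
    subordinator_right_continuous :
      {ae P, forall w, forall t : R, 0 <= t ->
         S s w @[s --> t^'+] --> S t w} ;
    subordinator_independent : independent_increments S ;
    subordinator_stationary : stationary_increments S
  }.

Record is_stable_subordinator (d : measure_display) (T : measurableType d)
    (R : realType) (P : probability T R) (theta : R)
    (S : R -> {RV P >-> R}) : Prop :=
  IsStableSubordinator {
    stable_subordinator_subordinator : is_subordinator S ;
    stable_subordinator_char_fun : forall t gamma : R, 0 <= t ->
      char_fun (S t) gamma
      = cexp (- ((t * `|gamma| `^ theta)%:C
                 * cexp (- ('i * (theta * pi / 2 * Num.sg gamma)%:C))))%C
  }.

(** ** The pseudo-process and its subordination *)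

(** Multiplier of the Riesz-Feller operator of order [alpha] and skewness
    [theta], for the convention F{f}(gamma) = \int exp (i gamma x) f(x) dx. *)
Definition riesz_feller_symbol (R : realType) (alpha theta gamma : R) : R[i] :=
  (- ((`|gamma| `^ alpha)%:C
      * cexp ('i * (pi * theta / 2 * Num.sg gamma)%:C)))%C.

(** Density of the signed measure P(X_alpha(s) \in dx), i.e. the fundamental
    solution (initial datum: the Dirac mass at 0) of the evolution equation
    driven by the Riesz-Feller operator of order [alpha] and skewness 1.
    The integrand is not Lebesgue integrable on the half-line: the integral is
    the limit of the integrals over [0, N] as N tends to infinity. *)
Definition pseudo_density (R : realType) (alpha x s : R) : R :=
  pi^-1 * lim ((\int[@lebesgue_measure R]_(gamma in `[0, N])
                  cos (gamma * x + s * gamma `^ alpha)) @[N --> +oo]).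

(** The integrand of [pseudo_density] is the real part of the Fourier inversion
    integrand of [exp (s * symbol)]; its values at [gamma] and [- gamma] are
    conjugate, hence the half-line and the factor [1 / pi]. *)
Lemma pseudo_density_integrandE (R : realType) (alpha x s gamma : R) :
  0 < gamma ->
  cos (gamma * x + s * gamma `^ alpha)
  = complex.Re (cexp (- ('i * (gamma * x)%:C))
                * cexp (s%:C * riesz_feller_symbol alpha 1 gamma))%C.
Proof.
move=> g0; rewrite /riesz_feller_symbol /cexp /= gtr0_sg// gtr0_norm//.
rewrite !(mulr1, mul1r, mul0r, mulr0, subr0, sub0r, addr0, add0r, oppr0, expR0).
by rewrite cos_pihalf sin_pihalf !(mulr0, mulr1, mul0r, oppr0, subr0, add0r,
  addr0, expR0, mul1r) mulrN !cosN !sinN mulrNN cosD.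
Qed.

(** Density at [x] of X_alpha(S_theta(t)), for [X_alpha] and [S_theta]
    independent: [h s t] stands for the density of [S_theta(t)] at [s]. *)
Definition subordinated_pseudo_density (R : realType) (alpha : R)
    (h : R -> R -> R) (x t : R) : \bar R :=
  (\int[@lebesgue_measure R]_(s in `]0%R, +oo[)
     (pseudo_density alpha x s * h s t)%:E)%E.

(** ** Generalized gamma distribution *)

Definition gen_gamma_pdf (R : realType) (gamma tau y : R) : R :=
  gamma * (y `^ (gamma - 1) / tau) * expR (- (y `^ gamma / tau)).

(* Main.v *)
(* Rotating the half-line of integration to the ray of argument
   [pi / (2 alpha)] (Cauchy's theorem on a circular sector, with a Jordan
   estimate on the arc) turns the conditionally convergent integral defining
   the pseudo-density into an absolutely convergent one, in which the time [s]
   only enters through [exp (- s y^alpha)].  By Fubini, subordination replaces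
   this factor by the Laplace transform of S_theta(t) at [y^alpha], that is
   [exp (- t y^(alpha theta))]; the condition [alpha theta > 1] gives the
   integrability.  An integration by parts then produces the generalized gamma
   density.

   The Laplace transform is recovered from the characteristic function by the
   mean value property on the unit disc: composed with the Cayley transform
   [w |-> (1 - w) / (1 + w)], the functions [z |-> exp (- c z)] and
   [z |-> exp (- c z^theta)] are harmonic and bounded, hence their values at
   the centre, i.e. at [z = 1], are averages of their values on the imaginary
   axis, i.e. of the characteristic functions. *)

Require Import Defs.
From HB Require Import structures.
From mathcomp Require Import all_boot all_order all_algebra.
From mathcomp Require Import all_classical all_reals all_analysis.
From mathcomp Require Import measurable_realfun complex ring lra.

Set Implicit Arguments.
Unset Strict Implicit.
Unset Printing Implicit Defensive.

Import Order.TTheory GRing.Theory Num.Theory numFieldNormedType.Exports.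
Import HBNNSimple.

Local Open Scope classical_set_scope.
Local Open Scope ring_scope.

(** * Integration and elementary bounds *)

(** Cauchy's theorem in real form: the x-derivative of the integrand is also a y-derivative, so
    differentiating under the integral leaves only boundary terms. It serves both the rotation of
    the ray and the circular means. *)
Lemma is_derive_Rintegral_exact (R : realType) (f df g : R -> R -> R)
    (u v a b C x : R) :
  a < b -> x \in `]u, v[ ->
  (forall x y, x \in `]u, v[ -> y \in `[a, b] ->
     is_derive x 1 (f^~ y) (df x y)) ->
  (forall x y, x \in `]u, v[ -> y \in `[a, b] -> `|df x y| <= C) ->
  (forall x, x \in `]u, v[ -> {within `[a, b], continuous f x}) ->
  (forall x, x \in `]u, v[ -> {within `[a, b], continuous df x}) ->
  (forall x, x \in `]u, v[ -> {within `[a, b], continuous g x}) ->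
  (forall x y, x \in `]u, v[ -> y \in `]a, b[ ->
     is_derive y 1 (g x) (df x y)) ->
  is_derive x 1 (fun x => \int[@lebesgue_measure R]_(y in `[a, b]) f x y)
    (g x b - g x a).
Proof.
move=> ab xuv fdf dfC cf cdf cg gdf.
have C0 : 0 <= C.
  by apply: le_trans (dfC x a xuv _) => //; rewrite in_itv/= lexx ltW.
have d1E z y : z \in `]u, v[ -> y \in `[a, b] -> partial1of2 f z y = df z y.
  by move=> zuv yab; rewrite /partial1of2 derive1E; case: (fdf z y zuv yab).
have intf z : `]u, v[%classic z ->
    (@lebesgue_measure R).-integrable `[a, b] (EFin \o f z).
  move=> zuv; apply: continuous_compact_integrable => //.
  - exact: segment_compact.
  - exact: cf.
have derf z y : `]u, v[%classic z -> `[a, b]%classic y -> derivable (f ^~ y) z 1.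
  by move=> zuv yab; case: (fdf z y zuv yab).
have intC : (@lebesgue_measure R).-integrable `[a, b] (EFin \o cst C).
  apply: continuous_compact_integrable => //; first exact: segment_compact.
  by apply: continuous_subspaceT; exact: cst_continuous.
have dle z y : `]u, v[%classic z -> `[a, b]%classic y -> `|partial1of2 f z y| <= cst C y.
  by move=> zuv yab; rewrite d1E//= dfC.
have mab : measurable (`[a, b]%classic : set R) by [].
apply: DeriveDef.
  exact: (@derivable_under_integral R _ _ (@lebesgue_measure R) f _ mab
    x u v xuv intf derf (cst C) (fun=> C0) intC dle).
rewrite -derive1E.
rewrite (@differentiation_under_integral R _ _ (@lebesgue_measure R) f _ mab
    x u v xuv intf derf (cst C) (fun=> C0) intC dle).
under eq_Rintegral => y yab.
  have -> : (partial1of2 f ^~ y) x = df x y.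
    by apply: d1E => //; move: yab; rewrite inE.
  over.
rewrite /Rintegral (@continuous_FTC2 _ _ (g x)) //.
- exact: cdf.
- have /(continuous_within_itvP _ ab)[_ ga gb] := cg _ xuv.
  by split=> // y yab; case: (gdf x y xuv yab).
- by move=> y yab; rewrite derive1E; case: (gdf x y xuv yab).
Qed.

(** Dominated convergence, with |f| dominating, along an arbitrary sequence of endpoints tending to
    [+oo]. *)
Lemma cvg_Rintegral_itv0y (R : realType) (f : R -> R) :
  (@lebesgue_measure R).-integrable `[0, +oo[ (EFin \o f) ->
  (\int[@lebesgue_measure R]_(y in `[0, N]) f y) @[N --> +oo] -->
    \int[@lebesgue_measure R]_(y in `[0, +oo[) f y.
Proof.
move=> intf; apply/cvg_pinftyP => N Ny.
have mf : measurable_fun (`[0, +oo[%classic : set R) f.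
  by case/integrableP : (intf) => /measurable_EFinP.
pose fn n := (EFin \o f) \_ (`[0, N n]%classic : set R).
have fE n : \int[@lebesgue_measure R]_(y in `[0, N n]) f y =
    fine (\int[@lebesgue_measure R]_(y in `[0, +oo[) fn n y).
  rewrite /Rintegral -integral_mkcondr; congr (fine (integral _ _ _)).
  apply/seteqP; split => y /=; rewrite !in_itv/= ?andbT.
    by move=> /andP[-> ->].
  by move=> [-> /andP[_ ->]].
under eq_fun do rewrite fE.
apply: fine_cvg; rewrite fineK; last exact: integrable_fin_num.
have [||||||_ _ +] := @dominated_convergence _ _ R (@lebesgue_measure R)
  (`[0, +oo[%classic : set R) _ fn (EFin \o f) (abse \o (EFin \o f)).
- by [].
- move=> n; apply/measurable_restrict => //.
  apply/measurable_EFinP; apply: measurable_funS mf => //.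
- exact/measurable_EFinP.
- apply: aeW => y /= y0; apply: cvg_near_cst.
  near=> n; rewrite /fn patchE mem_set//=; rewrite in_itv/=.
  move: y0; rewrite in_itv/= andbT => -> /=.
  by near: n; move/cvgryPge : Ny; exact.
- exact: integrable_abse.
- apply: aeW => y n /= y0; rewrite /fn patchE.
  by case: ifPn => // _; rewrite abse0.
exact.
Unshelve. all: by end_near. Qed.

(** Indicators by hypothesis, simple functions by linearity, then monotone approximation. *)
Lemma ge0_integral_density (d : measure_display) (T : measurableType d)
    (R : realType) (mu nu : {measure set T -> \bar R}) (D : set T)
    (f : T -> R) (g : T -> \bar R) :
  measurable D -> measurable_fun D f -> (forall y, D y -> 0 <= f y) ->
  (forall A, measurable A -> nu A = (\int[mu]_(y in A `&` D) (f y)%:E)%E) ->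
  measurable_fun [set: T] g -> (forall y, (0 <= g y)%E) ->
  (\int[nu]_y g y = \int[mu]_(y in D) (g y * (f y)%:E))%E.
Proof.
move=> mD mf f0 nuE mg g0.
have mEf : measurable_fun D (EFin \o f) by exact/measurable_EFinP.
have nu_indic (A : set T) : measurable A ->
    (\int[nu]_y (\1_A y)%:E = \int[mu]_(y in D) ((\1_A y)%:E * (f y)%:E))%E.
  move=> mA; rewrite integral_indic// setIT nuE//.
  rewrite setIC integral_mkcondr; apply: eq_integral => y _.
  by rewrite patchE indicE; case: ifPn => yA; rewrite ?mul1e ?mul0e.
have nu_nnsfun (h : {nnsfun T >-> R}) :
    (\int[nu]_y (h y)%:E = \int[mu]_(y in D) ((h y)%:E * (f y)%:E))%E.
  under [LHS]eq_integral do rewrite fimfunE -fsumEFin//.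
  rewrite [LHS]ge0_integral_fsum//; last 2 first.
    by move=> r; exact/measurable_EFinP/measurableT_comp.
    by move=> n x _; rewrite EFinM nnfun_muleindic_ge0.
  under [RHS]eq_integral => y yD.
    rewrite fimfunE -fsumEFin// ge0_mule_fsuml; last first.
      by move=> r; rewrite EFinM nnfun_muleindic_ge0.
    over.
  rewrite [RHS]ge0_integral_fsum//; last 2 first.
    move=> r; apply: emeasurable_funM => //.
    by apply/measurable_EFinP; apply/measurable_funTS/measurableT_comp.
    move=> n x Dx; rewrite mule_ge0 ?lee_fin ?f0//.
    by rewrite -lee_fin EFinM nnfun_muleindic_ge0.
  apply: eq_fsbigr => r /[!inE] -[t _ <-].
  rewrite integralZl_indic_nnsfun// nu_indic//.
  rewrite -ge0_integralZl ?lee_fin//; last 2 first.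
    apply: emeasurable_funM => //.
    by apply/measurable_EFinP/measurable_funTS.
    by move=> x Dx; rewrite mule_ge0// lee_fin// f0.
  by apply: eq_integral => y _; rewrite EFinM muleA.
pose h := nnsfun_approx measurableT mg.
transitivity (lim (\int[nu]_y (h n y)%:E @[n --> \oo])%E).
  rewrite -monotone_convergence//=.
  - apply: eq_integral => ? /[!inE] xD; apply/esym/cvg_lim => //=.
    exact: cvg_nnsfun_approx.
  - by move=> n; exact/measurable_EFinP/measurable_funTS.
  - by move=> n ? _; rewrite lee_fin.
  - by move=> ? _ ? ? mn; rewrite lee_fin; exact/lefP/nd_nnsfun_approx.
under eq_fun do rewrite nu_nnsfun.
rewrite -monotone_convergence//=.
- apply: eq_integral => y /[!inE] yD; apply/cvg_lim => //=.
  by apply: cvgeZr => //; exact: cvg_nnsfun_approx.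
- move=> n; apply: emeasurable_funM => //.
  by apply/measurable_EFinP/measurable_funTS.
- by move=> n y yD; rewrite mule_ge0// lee_fin// f0.
- move=> y yD m n mn; rewrite lee_wpmul2r// ?lee_fin ?f0//.
  exact/lefP/nd_nnsfun_approx.
Qed.

(* The measurable structure of [lebesgue_measure R] is not the canonical one of
   [R], although both are the Borel sigma-algebra: stating the change of
   variables along a map [X] allows [X := idfun] to bridge the two. *)
Lemma integral_density (d d' : measure_display) (T : measurableType d)
    (T' : measurableType d') (R : realType)
    (mu : {measure set T -> \bar R}) (nu : {measure set T' -> \bar R})
    (X : T' -> T) (D : set T) (f g : T -> R) :
  measurable_fun [set: T'] X ->
  measurable D -> measurable_fun D f -> (forall y, D y -> 0 <= f y) ->
  (forall A, measurable A ->
    nu (X @^-1` A) = (\int[mu]_(y in A `&` D) (f y)%:E)%E) ->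
  measurable_fun [set: T] g ->
  (\int[nu]_w (g (X w))%:E = \int[mu]_(y in D) (g y * f y)%:E)%E.
Proof.
move=> mX mD mf f0 nuE mg.
pose nuX : {measure set T -> \bar R} :=
  measure_function_pushforward__canonical__measure_function_Measure nu mX.
have ge0E (k : T -> \bar R) : measurable_fun [set: T] k ->
    (forall y, 0 <= k y)%E ->
    (\int[nu]_w k (X w) = \int[mu]_(y in D) (k y * (f y)%:E))%E.
  move=> mk k0; rewrite -(@ge0_integral_density _ _ _ mu nuX)//.
  by rewrite (@ge0_integral_pushforward _ _ _ _ _ X).
have mEg : measurable_fun [set: T] (EFin \o g) by exact/measurable_EFinP.
rewrite integralE [RHS]integralE; congr (_ - _)%E.
  rewrite (_ : (fun w => (g (X w))%:E)^\+%E =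
      fun w => (fun y => (g y)%:E)^\+%E (X w)); last first.
    by apply/funext => w; rewrite !funeposE.
  rewrite ge0E//; last exact: measurable_funepos.
  apply: eq_integral => y /[!inE] /f0 fy0.
  by rewrite !funeposE -!EFin_max -EFinM maxr_pMl// mul0r.
rewrite (_ : (fun w => (g (X w))%:E)^\-%E =
    fun w => (fun y => (g y)%:E)^\-%E (X w)); last first.
  by apply/funext => w; rewrite !funenegE.
rewrite ge0E//; last exact: measurable_funeneg.
apply: eq_integral => y /[!inE] /f0 fy0.
by rewrite !funenegE -!EFinN -mulNr -!EFin_max -EFinM maxr_pMl// mul0r.
Qed.

Lemma continuous_powR_norm (R : realType) (p : R) : 0 < p ->
  continuous (fun y : R => `|y| `^ p).
Proof.
move=> p0 y; have [->|y0] := eqVneq y 0; last first.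
  apply: (@continuous_comp _ _ _ (@Num.norm R R) (fun z : R => z `^ p)).
    exact: norm_continuous.
  apply/differentiable_continuous/derivable1_diffP/derivable_powR.
  by rewrite in_itv/= normr_gt0 y0.
apply/cvgrPdist_lt => e e0; near=> z.
rewrite normr0 powR0 ?gt_eqF// sub0r normrN ger0_norm ?powR_ge0//.
have -> : e = (e `^ p^-1) `^ p.
  by rewrite -powRrM mulVf ?gt_eqF// powRr1// ltW.
apply: gt0_ltr_powR => //; rewrite ?nnegrE ?powR_ge0//.
near: z; apply/nbhs_ballP; exists (e `^ p^-1) => /=; first exact: powR_gt0.
by move=> w; rewrite /ball/= sub0r normrN.
Unshelve. all: by end_near. Qed.

Lemma linear_sub_powR_le (R : realType) (B s p : R) : 0 < s -> 1 < p ->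
  exists C, forall y, 0 <= y -> B * y - s * y `^ p <= C - y.
Proof.
(* Past [y0], s y^(p - 1) >= |B| + 1 and the power absorbs both linear terms; below [y0], the
   constant does. *)
move=> s0 p1; pose y0 := ((`|B| + 1) / s) `^ (p - 1)^-1.
have p10 : 0 < p - 1 by rewrite subr_gt0.
have p0 : 0 < p by rewrite (lt_trans _ p1).
have y00 : 0 <= y0 by exact: powR_ge0.
have B10 : 0 <= (`|B| + 1) / s by rewrite divr_ge0 ?addr_ge0// ltW.
exists ((`|B| + 1) * y0) => y yge0.
have By : B * y <= `|B| * y by rewrite ler_wpM2r// ler_norm.
suff : (`|B| + 1) * y <= (`|B| + 1) * y0 + s * y `^ p by lra.
have [y0y|yy0] := leP y0 y; last first.
  rewrite -[leLHS]addr0 lerD ?ler_wpM2l ?addr_ge0 ?(ltW yy0)//.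
  by rewrite mulr_ge0 ?powR_ge0// ltW.
have le1 : (`|B| + 1) / s <= y `^ (p - 1).
  have -> : (`|B| + 1) / s = y0 `^ (p - 1).
    by rewrite /y0 -powRrM mulVf ?gt_eqF// powRr1.
  by apply: ge0_ler_powR => //; rewrite ?nnegrE// ltW.
rewrite -(mulr_powRB1 yge0 p0) -[leLHS]add0r lerD//.
  by rewrite mulr_ge0// addr_ge0.
by rewrite mulrCA mulrC ler_wpM2l// mulrC -ler_pdivrMr.
Qed.

(** By [linear_sub_powR_le] the bound decays at least like exp (- y), so a multiple of the
    exponential density dominates. *)
Lemma integrable_le_expR_powR (R : realType) (M B s p : R) (g : R -> R) :
  0 < s -> 1 < p -> measurable_fun (`[0, +oo[%classic : set R) g ->
  (forall y, 0 <= y -> `|g y| <= M * expR (B * y - s * y `^ p)) ->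
  (@lebesgue_measure R).-integrable `[0, +oo[ (EFin \o g).
Proof.
move=> s0 p1 mg gle; have [C leC] := linear_sub_powR_le B s0 p1.
have int1 : (@lebesgue_measure R).-integrable `[0, +oo[
    (fun y => (M * expR C * exponential_pdf 1 y)%:E).
  apply: (@integrableS _ _ _ _ setT) => //.
  under eq_fun do rewrite EFinM.
  by apply: integrableZl => //; exact: integrable_exponential_pdf.
apply: le_integrable int1 => //; first exact/measurable_EFinP.
move=> y /=; rewrite in_itv/= andbT => y0.
have M0 : 0 <= M.
  rewrite -(pmulr_lge0 _ (expR_gt0 (B * y - s * y `^ p))).
  exact: le_trans (gle _ y0).
rewrite lee_fin (le_trans (gle _ y0))// exponential_pdfE// mul1r.
rewrite ger0_norm ?mulr_ge0 ?expR_ge0// -mulrA ler_wpM2l// -expRD ler_expR mulN1r.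
exact: leC.
Qed.

Lemma sin_le_id (R : realType) (x : R) : 0 <= x -> sin x <= x.
Proof.
move=> x0; rewrite -subr_ge0.
have -> : 0 = (0 : R) - sin 0 by rewrite sin0 subr0.
apply: (@ger0_derive1_ndecry _ (fun x : R => x - sin x) 0) => //.
- by move=> y y0; rewrite derive1E derive_val subr_ge0 cos_le1.
- apply: continuous_subspaceT => y; apply: continuousB => //.
  exact: continuous_sin.
Qed.

(** A weak Jordan inequality, with 1/2 for 2/pi: combine v cos v <= sin v at v = x/2, the
    duplication formula, and cos^2 (x/2) >= 1/2, which holds since cos x >= 0. *)
Lemma sin_ge_half (R : realType) (x : R) : 0 <= x <= pi / 2 -> x / 2 <= sin x.
Proof.
move=> /andP[x0 xpi]; have p0 := pi_gt0 R.
have le_sin (v : R) : 0 <= v <= pi / 4 -> v * cos v <= sin v.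
  move=> /andP[v0 v4]; rewrite -subr_ge0.
  have -> : 0 = sin 0 - 0 * cos 0 :> R by rewrite sin0 mul0r subr0.
  apply: (@ger0_derive1_ndecr _ (fun x : R => sin x - x * cos x) 0 (pi / 4)) => //.
  - move=> y /[!in_itv]/= /andP[y0 y4]; rewrite derive1E derive_val /=.
    have : 0 <= y * sin y.
      by rewrite mulr_ge0 ?(ltW y0)// sin_ge0_pi// (ltW y0)/=; lra.
    rewrite /GRing.scale /=; lra.
  - apply: continuous_subspaceT => y.
    exact/differentiable_continuous/derivable1_diffP.
have -> : sin x = 2 * (cos (x / 2) * sin (x / 2)).
  rewrite mulr_natl -sin_mulr2n; congr sin; rewrite -mulr_natr; lra.
have c2 : 2^-1 <= cos (x / 2) ^+ 2.
  have : 0 <= cos x by apply: cos_ge0_pihalf; lra.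
  have -> : cos x = cos (x / 2) ^+ 2 *+ 2 - 1.
    rewrite -cos_mulr2n; congr cos; rewrite -mulr_natr; lra.
  rewrite -mulr_natr; lra.
have c0 : 0 <= cos (x / 2) by apply: cos_ge0_pihalf; lra.
have h := le_sin (x / 2).
have {}h : x / 2 * cos (x / 2) <= sin (x / 2) by apply: h; lra.
have : cos (x / 2) * (x / 2 * cos (x / 2)) <= cos (x / 2) * sin (x / 2).
  by rewrite ler_wpM2l.
have : x * 2^-1 <= x * cos (x / 2) ^+ 2 by rewrite ler_wpM2l.
rewrite expr2; lra.
Qed.

(** * Rotation of the half-line *)

Lemma cvg_realfun (R : realType) (T : Type) (F : set_system T) (h : R -> R)
    (f : T -> R) (a : R) {FF : Filter F} :
  continuous h -> f x @[x --> F] --> a -> h (f x) @[x --> F] --> h a.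
Proof. by move=> ch fa; apply: continuous_cvg => //; exact: ch. Qed.

(** One step of a syntax-directed limit computation. Subtraction is matched before addition, of
    which it is a special case. *)
Ltac cont_step :=
  match goal with |- context [@fmap ?T ?U ?f ?F] =>
  lazymatch f with
  | fun _ => ?c => exact: cvg_cst
  | fun y => y => exact: cvg_id
  | fun y => @GRing.opp _ (@?g y) => apply: cvgN
  | fun y => @GRing.add _ (@?g y) (@GRing.opp _ (@?h y)) => apply: cvgB
  | fun y => @GRing.add _ (@?g y) (@?h y) => apply: cvgD
  | fun y => @GRing.mul _ (@?g y) (@?h y) => apply: cvgM
  | fun y => @expR _ (@?g y) => apply: (cvg_realfun (@continuous_expR _))
  | fun y => @sin _ (@?g y) => apply: (cvg_realfun (@continuous_sin _))
  | fun y => @cos _ (@?g y) => apply: (cvg_realfun (@continuous_cos _))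
  | @cos _ => exact: continuous_cos
  | @sin _ => exact: continuous_sin
  | fun y => @powR _ (@Num.norm _ _ y) _ =>
      apply: continuous_powR_norm; assumption
  | ?k => match goal with H : continuous k |- _ => exact: H end
  end end.

Ltac continuity := rewrite /continuous_at; cbv beta; repeat cont_step.

(* With [f z = exp (i (x z + s z^alpha))], [ray_exponent + i ray_phase] is the
   logarithm of [exp (i phi) f (y exp (i phi))]; [ray_potential] is the real
   part of [i y exp (i phi) f (y exp (i phi))], whose derivative in [y] equals
   that of [ray_integrand] in [phi].  The absolute value makes [y^alpha]
   continuous at 0, since [powR] is 1 on negative reals. *)
Definition ray_exponent (R : realType) (alpha x s phi y : R) : R :=
  - (x * (y * sin phi)) - s * (`|y| `^ alpha * sin (alpha * phi)).

Definition ray_phase (R : realType) (alpha x s phi y : R) : R :=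
  phi + x * (y * cos phi) + s * (`|y| `^ alpha * cos (alpha * phi)).

Definition ray_integrand (R : realType) (alpha x s phi y : R) : R :=
  expR (ray_exponent alpha x s phi y) * cos (ray_phase alpha x s phi y).

Definition ray_potential (R : realType) (alpha x s phi y : R) : R :=
  - (y * expR (ray_exponent alpha x s phi y) * sin (ray_phase alpha x s phi y)).

Definition ray_derivative (R : realType) (alpha x s phi y : R) : R :=
  expR (ray_exponent alpha x s phi y) *
  ((- (x * (y * cos phi)) - s * (`|y| `^ alpha * (alpha * cos (alpha * phi))))
     * cos (ray_phase alpha x s phi y)
   - (1 - x * (y * sin phi) - s * (`|y| `^ alpha * (alpha * sin (alpha * phi))))
     * sin (ray_phase alpha x s phi y)).

Lemma is_derive_ray_integrand (R : realType) (alpha x s phi y : R) :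
  is_derive phi 1 ((ray_integrand alpha x s)^~ y)
    (ray_derivative alpha x s phi y).
Proof.
rewrite /ray_integrand /ray_derivative /ray_exponent /ray_phase.
apply: is_derive_eq; rewrite /GRing.scale/=.
ring.
Qed.

Lemma is_derive_ray_potential (R : realType) (alpha x s phi y : R) :
  0 < alpha -> 0 < y ->
  is_derive y 1 (ray_potential alpha x s phi)
    (ray_derivative alpha x s phi y).
Proof.
move=> al0 y0.
have nyE : \near y, y `^ alpha = `|y| `^ alpha.
  near=> z; rewrite ger0_norm//.
  by apply: ltW; near: z; exact: lt_nbhsr.
have dw : is_derive y 1 (fun y => `|y| `^ alpha) (alpha * y `^ (alpha - 1)).
  by apply: near_eq_is_derive nyE _; exact: is_derive1_powR.
rewrite /ray_potential /ray_derivative /ray_exponent /ray_phase.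
apply: is_derive_eq; rewrite /GRing.scale/= gtr0_norm//.
rewrite -(mulr_powRB1 (ltW y0) al0).
ring.
Unshelve. all: by end_near. Qed.

Lemma continuous_ray (R : realType) (alpha x s phi : R) : 0 < alpha ->
  [/\ continuous (ray_integrand alpha x s phi),
      continuous (ray_potential alpha x s phi) &
      continuous (ray_derivative alpha x s phi)].
Proof.
move=> al0; rewrite /ray_integrand /ray_potential /ray_derivative /ray_exponent.
by rewrite /ray_phase; split => z; continuity.
Qed.

Lemma ray_derivative_bound (R : realType) (alpha x s phi y N : R) :
  0 < alpha -> 0 <= s -> 0 <= y <= N ->
  `|ray_derivative alpha x s phi y| <=
  expR (`|x| * N + s * N `^ alpha) *
    ((`|x| * N + s * (N `^ alpha * alpha)) * 1 +
     (1 + `|x| * N + s * (N `^ alpha * alpha)) * 1).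
Proof.
move=> al0 s0 /andP[y0 yN]; have N0 : 0 <= N := le_trans y0 yN.
have wN : `| `|y| `^ alpha | <= N `^ alpha.
  rewrite (ger0_norm (powR_ge0 _ _)) (ger0_norm y0).
  by apply: ge0_ler_powR => //; rewrite ?nnegrE// ltW.
have bxy u : `|u| <= 1 -> `|x * (y * u)| <= `|x| * N.
  move=> u1; rewrite !normrM ler_wpM2l// -[leRHS]mulr1 ler_pM//.
  by rewrite ger0_norm.
have bsw u : `|u| <= 1 -> `|s * (`|y| `^ alpha * u)| <= s * N `^ alpha.
  move=> u1; rewrite !normrM (ger0_norm s0) ler_wpM2l//.
  by rewrite -[leRHS]mulr1 ler_pM.
have bswa u : `|u| <= 1 ->
    `|s * (`|y| `^ alpha * (alpha * u))| <= s * (N `^ alpha * alpha).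
  move=> u1; rewrite !normrM (ger0_norm s0) ler_wpM2l//.
  rewrite ler_pM// (gtr0_norm al0) -[leRHS]mulr1 ler_wpM2l// ltW//.
rewrite /ray_derivative normrM ger0_norm ?expR_ge0// ler_pM ?expR_ge0//.
  rewrite ler_expR /ray_exponent lerD//.
    by rewrite (le_trans (ler_norm _))// normrN bxy// sin_max.
  by rewrite (le_trans (ler_norm _))// normrN bsw// sin_max.
rewrite (le_trans (ler_normB _ _))// !normrM lerD// ler_pM// ?cos_max ?sin_max//.
  rewrite (le_trans (ler_normB _ _))// normrN lerD//.
    by rewrite bxy// cos_max.
  by rewrite bswa// cos_max.
rewrite (le_trans (ler_normB _ _))// lerD//.
  by rewrite (le_trans (ler_normB _ _))// normr1 lerD// bxy// sin_max.
by rewrite bswa// sin_max.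
Qed.

Lemma is_derive_ray_integral (R : realType) (alpha x s N phi : R) :
  0 < alpha -> 0 <= s -> 0 < N ->
  is_derive phi 1
    (fun phi => \int[@lebesgue_measure R]_(y in `[0, N])
                  ray_integrand alpha x s phi y)
    (ray_potential alpha x s phi N).
Proof.
move=> al0 s0 N0.
(* The potential carries a factor y, so the endpoint 0 contributes nothing. *)
have -> : ray_potential alpha x s phi N =
    ray_potential alpha x s phi N - ray_potential alpha x s phi 0.
  by rewrite {3}/ray_potential !mul0r oppr0 subr0.
apply: (@is_derive_Rintegral_exact _ (ray_integrand alpha x s)
  (ray_derivative alpha x s) (ray_potential alpha x s)
  (phi - 1) (phi + 1) 0 N
  (expR (`|x| * N + s * N `^ alpha) *
    ((`|x| * N + s * (N `^ alpha * alpha)) * 1 +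
     (1 + `|x| * N + s * (N `^ alpha * alpha)) * 1)) phi N0).
- by rewrite in_itv/= gtrBl ltrDl ltr01.
- by move=> ? ? _ _; exact: is_derive_ray_integrand.
- move=> z y _; rewrite in_itv/= => y0N; exact: ray_derivative_bound y0N.
- by move=> z _; apply: continuous_subspaceT; case: (continuous_ray x s z al0).
- by move=> z _; apply: continuous_subspaceT; case: (continuous_ray x s z al0).
- by move=> z _; apply: continuous_subspaceT; case: (continuous_ray x s z al0).
- move=> z y _; rewrite in_itv/= => /andP[y0 _].
  exact: is_derive_ray_potential.
Qed.

(* A Jordan-type estimate: on the arc of radius [N] the integrand decays like
   [exp (- K phi)] with [K] the denominator below. *)
Lemma ray_integral_diff_le (R : realType) (alpha x s N : R) :
  1 < alpha -> 0 < s -> 0 < N ->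
  let K := s * alpha / 2 * N `^ alpha - `|x| * N in
  let J phi := \int[@lebesgue_measure R]_(y in `[0, N])
                 ray_integrand alpha x s phi y in
  0 < K -> `|J (pi / (2 * alpha)) - J 0| <= N / K.
Proof.
move=> al1 s0 N0 K J K0; set phi0 := pi / (2 * alpha).
have al0 : 0 < alpha by rewrite (lt_trans _ al1).
have pi0 := pi_gt0 R.
have alphi0 : alpha * phi0 = pi / 2 by rewrite /phi0; field; rewrite gt_eqF.
have phi0_gt0 : 0 < phi0 by rewrite divr_gt0// mulr_gt0.
have dJ (phi : R) : is_derive phi 1 J (ray_potential alpha x s phi N).
  by apply: is_derive_ray_integral => //; exact: ltW.
(* The exponent is at most - K phi, because sin (alpha phi) >= alpha phi / 2 and 0 <= sin phi <= phi
   in this range. *)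
have potle (phi : R) : 0 < phi < phi0 ->
    `|ray_potential alpha x s phi N| <= N * expR (- K * phi).
  move=> /andP[p0 pphi0].
  rewrite normrN !normrM (gtr0_norm N0) -mulrA ler_wpM2l ?(ltW N0)//.
  rewrite -[leRHS]mulr1 ler_pM// ?sin_max// ger0_norm ?expR_ge0// ler_expR.
  rewrite /ray_exponent (gtr0_norm N0).
  have sal : alpha * phi / 2 <= sin (alpha * phi).
    apply: sin_ge_half; rewrite -alphi0 mulr_ge0 ?(ltW p0) ?(ltW al0)//=.
    by rewrite ler_wpM2l// ltW.
  have : - (x * (N * sin phi)) <= `|x| * (N * phi).
    rewrite (le_trans (ler_norm _))// normrN !normrM (gtr0_norm N0).
    rewrite ler_wpM2l// ler_wpM2l ?(ltW N0)// ger0_norm ?sin_le_id ?(ltW p0)//.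
    rewrite sin_ge0_pi// (ltW p0) (le_trans (ltW pphi0))// /phi0.
    rewrite ler_pdivrMr ?mulr_gt0// ler_peMr ?(ltW pi0)//; lra.
  have : s * (N `^ alpha * (alpha * phi / 2)) <=
         s * (N `^ alpha * sin (alpha * phi)).
    by rewrite ler_wpM2l ?(ltW s0)// ler_wpM2l// powR_ge0.
  rewrite /K; lra.
(* The second term has derivative - N exp (- K phi), so [D e] is nonincreasing for e = 1 and e = -1;
   comparing its values at [phi0] and 0 gives the two-sided bound. *)
pose D (e phi : R) := e * J phi + N / K * expR (- K * phi).
have D_nincr (e : R) : `|e| = 1 -> D e phi0 <= D e 0.
  move=> e1.
  have dD (phi : R) : is_derive phi 1 (D e)
      (e * ray_potential alpha x s phi N - N * expR (- K * phi)).
    rewrite /D; apply: is_derive_eq; rewrite /GRing.scale/=.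
    by field; rewrite gt_eqF.
  apply: (@ler0_derive1_nincr _ (D e) 0 phi0) => //; last exact: ltW.
  - move=> p p0; rewrite derive1E derive_val subr_le0.
    rewrite (le_trans (ler_norm _))// normrM e1 mul1r potle//.
  - apply: continuous_subspaceT => p.
    by apply/differentiable_continuous/derivable1_diffP.
have NK : 0 < N / K by rewrite divr_gt0.
have := D_nincr 1 (normr1 _); have := D_nincr (-1) (normrN1 _).
rewrite /D mulr0 expR0 !mulr1 !mul1r !mulN1r.
have : 0 <= N / K * expR (- K * phi0) by rewrite mulr_ge0 ?expR_ge0// ltW.
rewrite ler_norml; lra.
Qed.

Lemma ray_exponent_pihalf (R : realType) (alpha x s y : R) : 0 < alpha ->
  ray_exponent alpha x s (pi / (2 * alpha)) y =
  - (x * (y * sin (pi / (2 * alpha)))) - s * `|y| `^ alpha.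
Proof.
move=> al0; rewrite /ray_exponent.
have -> : alpha * (pi / (2 * alpha)) = pi / 2 by field; rewrite gt_eqF.
by rewrite sin_pihalf mulr1.
Qed.

Lemma ray_phase_pihalf (R : realType) (alpha x s y : R) : 0 < alpha ->
  ray_phase alpha x s (pi / (2 * alpha)) y =
  pi / (2 * alpha) + x * (y * cos (pi / (2 * alpha))).
Proof.
move=> al0; rewrite /ray_phase.
have -> : alpha * (pi / (2 * alpha)) = pi / 2 by field; rewrite gt_eqF.
by rewrite cos_pihalf !mulr0 addr0.
Qed.

Lemma integrable_ray_integrand (R : realType) (alpha x s : R) :
  1 < alpha -> 0 < s ->
  (@lebesgue_measure R).-integrable `[0, +oo[
    (EFin \o ray_integrand alpha x s (pi / (2 * alpha))).
Proof.
move=> al1 s0; have al0 : 0 < alpha by rewrite (lt_trans _ al1).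
apply: (@integrable_le_expR_powR _ 1 `|x| s alpha) => //.
  apply: measurable_funTS; apply: continuous_measurable_fun.
  by case: (continuous_ray x s (pi / (2 * alpha)) al0).
move=> y y0; rewrite normrM ger0_norm ?expR_ge0// -[leRHS]mulr1 mul1r.
rewrite ler_pM ?expR_ge0 ?cos_max// ler_expR ray_exponent_pihalf// ger0_norm//.
rewrite lerD2r (le_trans (ler_norm _))// normrN !normrM ler_wpM2l//.
by rewrite (ger0_norm y0) -[leRHS]mulr1 ler_wpM2l// sin_max.
Qed.

(** The rotated integral converges by integrability, and the arc contributes at most N / K, where K
    grows like N^alpha with alpha > 1. *)
Lemma cvg_ray_integral0 (R : realType) (alpha x s : R) :
  1 < alpha -> 0 < s ->
  \int[@lebesgue_measure R]_(y in `[0, N]) ray_integrand alpha x s 0 y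
    @[N --> +oo] -->
  \int[@lebesgue_measure R]_(y in `[0, +oo[)
    ray_integrand alpha x s (pi / (2 * alpha)) y.
Proof.
move=> al1 s0; have al0 : 0 < alpha by rewrite (lt_trans _ al1).
have cvgphi0 := cvg_Rintegral_itv0y (integrable_ray_integrand x al1 s0).
set I := (X in _ --> X).
apply: cvg_zero; apply: (cvg_trans _ (_ : (fun N =>
  \int[@lebesgue_measure R]_(y in `[0, N]) ray_integrand alpha x s 0 y - 
  \int[@lebesgue_measure R]_(y in `[0, N])
    ray_integrand alpha x s (pi / (2 * alpha)) y + 
  (\int[@lebesgue_measure R]_(y in `[0, N])
    ray_integrand alpha x s (pi / (2 * alpha)) y - I)) @ +oo --> (0 : R))).
  by apply: near_eq_cvg; near=> N; rewrite addrA subrK.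
rewrite -[X in _ --> X]addr0; apply: cvgD; last exact/subr_cvg0.
apply/cvgr0Pnorm_le => e e0.
have s20 : 0 < s * alpha / 2 by rewrite !mulr_gt0.
(* The slope |x| + 1/e yields K >= N / e once N >= C, hence N / K <= e. *)
have [C leC] := linear_sub_powR_le (`|x| + e^-1) s20 al1.
near=> N.
have N0 : 0 < N by [].
have NC : C <= N by [].
have ei0 : 0 < e^-1 by rewrite invr_gt0.
have NeK : N / e <= s * alpha / 2 * N `^ alpha - `|x| * N.
  by have := leC _ (ltW N0); lra.
have K0 : 0 < s * alpha / 2 * N `^ alpha - `|x| * N.
  by rewrite (lt_le_trans _ NeK)// divr_gt0.
rewrite distrC (le_trans (ray_integral_diff_le al1 s0 N0 K0))//.
by rewrite ler_pdivrMr// mulrC -ler_pdivrMr.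
Unshelve. all: by end_near. Qed.

(* Rotating the half-line of integration to the ray of argument
   [pi / (2 alpha)] turns [exp (i s gamma^alpha)] into [exp (- s y^alpha)] and
   makes the integral absolutely convergent. *)
Lemma pseudo_densityE (R : realType) (alpha x s : R) : 1 < alpha -> 0 < s ->
  pseudo_density alpha x s = pi^-1 *
    \int[@lebesgue_measure R]_(y in `[0, +oo[)
      ray_integrand alpha x s (pi / (2 * alpha)) y.
Proof.
move=> al1 s0; rewrite /pseudo_density; congr (_ * _).
apply/cvg_lim => //.
under eq_fun => N.
  under eq_Rintegral => y y0.
    have -> : cos (y * x + s * y `^ alpha) = ray_integrand alpha x s 0 y.
      move: y0; rewrite inE/= in_itv/= => /andP[y0 _].
      rewrite /ray_integrand /ray_exponent /ray_phase ger0_norm//.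
      by rewrite !mulr0 sin0 !mulr0 oppr0 addr0 expR0 cos0 !mulr1 mul1r add0r
        mulrC.
    over.
  over.
exact: cvg_ray_integral0.
Qed.

(** * Mean value property on the disc *)

(* Cauchy-Riemann equations in polar coordinates [r, b] for the function
   [p - i q], of radial derivative [pr - i qr]. *)
Definition polar_CR (R : realType) (p q pr qr : R -> R -> R) (r : R) : Prop :=
  forall b, [/\ is_derive r 1 (p^~ b) (pr r b), is_derive r 1 (q^~ b) (qr r b),
    is_derive b 1 (p r) (r * qr r b) & is_derive b 1 (q r) (- (r * pr r b))].

Lemma polar_CR_scale (R : realType) (p q pr qr : R -> R -> R) (r k : R) :
  polar_CR p q pr qr r ->
  polar_CR (fun r b => k * p r b) (fun r b => k * q r b)
    (fun r b => k * pr r b) (fun r b => k * qr r b) r.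
Proof.
move=> pq b; have [h1 h2 h3 h4] := pq b.
by split; apply: is_derive_eq; rewrite /GRing.scale/=; ring.
Qed.

(** Composition of p - i q with the exponential. Alternated with [polar_CR_scale], it turns a
    logarithm into z^theta, then into exp (- c z^theta). *)
Lemma polar_CR_exp (R : realType) (p q pr qr : R -> R -> R) (r : R) :
  polar_CR p q pr qr r ->
  polar_CR (fun r b => expR (p r b) * cos (q r b))
    (fun r b => expR (p r b) * sin (q r b))
    (fun r b => expR (p r b) * (pr r b * cos (q r b) - qr r b * sin (q r b)))
    (fun r b => expR (p r b) * (pr r b * sin (q r b) + qr r b * cos (q r b))) r.
Proof.
move=> pq b; have [h1 h2 h3 h4] := pq b.
by split; apply: is_derive_eq; rewrite /GRing.scale/=; ring.
Qed.

(* [disc_ln r b - i * disc_arg r b] is the principal logarithm of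
   [(1 - w) / (1 + w)], where [w = r exp (i b)]. *)
Definition disc_ln (R : realType) (r b : R) : R :=
  (ln (1 - 2 * r * cos b + r ^+ 2) - ln (1 + 2 * r * cos b + r ^+ 2)) / 2.

Definition disc_arg (R : realType) (r b : R) : R :=
  atan (2 * r * sin b / (1 - r ^+ 2)).

(** This is |1 - w^2|^2. The radial derivative of the logarithm is -2 exp (i b) / (1 - w^2); its
    real part and negated imaginary part are the next two definitions. *)
Definition disc_norm2 (R : realType) (r b : R) : R :=
  (1 - 2 * r * cos b + r ^+ 2) * (1 + 2 * r * cos b + r ^+ 2).

Definition disc_ln_dr (R : realType) (r b : R) : R :=
  - (2 * cos b * (1 - r ^+ 2)) / disc_norm2 r b.

Definition disc_arg_dr (R : realType) (r b : R) : R :=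
  2 * sin b * (1 + r ^+ 2) / disc_norm2 r b.

Lemma disc_factor_ge (R : realType) (r b : R) : 0 <= r ->
  (1 - r) ^+ 2 <= 1 - 2 * r * cos b + r ^+ 2 <= (1 + r) ^+ 2 /\
  (1 - r) ^+ 2 <= 1 + 2 * r * cos b + r ^+ 2 <= (1 + r) ^+ 2.
Proof.
move=> r0; have := cos_le1 b; have := cos_geN1 b => c1 c2.
have h1 : r * -1 <= r * cos b by rewrite ler_wpM2l.
have h2 : r * cos b <= r * 1 by rewrite ler_wpM2l.
by rewrite !expr2; split; apply/andP; split; lra.
Qed.

Lemma disc_factor_gt0 (R : realType) (r b : R) : 0 <= r < 1 ->
  0 < 1 - 2 * r * cos b + r ^+ 2 /\ 0 < 1 + 2 * r * cos b + r ^+ 2.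
Proof.
move=> /andP[r0 r1]; have [/andP[h1 _] /andP[h2 _]] := disc_factor_ge b r0.
have r2 : 0 < (1 - r) ^+ 2 by rewrite exprn_gt0// subr_gt0.
by split; [exact: lt_le_trans h1|exact: lt_le_trans h2].
Qed.

Lemma polar_CR_disc (R : realType) (r : R) : 0 <= r < 1 ->
  polar_CR (@disc_ln R) (@disc_arg R) (@disc_ln_dr R) (@disc_arg_dr R) r.
Proof.
move=> r01 b; have [A0 B0] := disc_factor_gt0 b r01.
have C0 : 0 < 1 - r ^+ 2.
  by case/andP: r01 => r0 r1; rewrite subr_gt0 expr_lt1.
have [An0 Bn0 Cn0] : [/\ 1 - 2 * r * cos b + r ^+ 2 != 0,
    1 + 2 * r * cos b + r ^+ 2 != 0 & 1 - r ^+ 2 != 0].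
  by rewrite !gt_eqF.
have dlnA := is_derive1_ln A0; have dlnB := is_derive1_ln B0.
have dV : is_derive r 1 (fun r : R => (1 - r ^+ 2)^-1)
    (2 * r / (1 - r ^+ 2) ^+ 2).
  have dC : is_derive r 1 (fun r : R => 1 - r ^+ 2) (- (2 * r)).
    by apply: is_derive_eq; rewrite /GRing.scale/=; ring.
  apply: (is_derive_eq (@is_deriveV _ (fun r : R => 1 - r ^+ 2) _ _ _ Cn0 dC)).
  by rewrite /GRing.scale/=; field.
have s2 : sin b ^+ 2 = 1 - cos b ^+ 2 by exact: sin2cos2.
(* Both sides are the squared modulus of (1 - w) (1 + conj w) = 1 - r^2 - 2 i r sin b, which has the
   same argument as (1 - w) / (1 + w). *)
have D0 : (1 - r ^+ 2) ^+ 2 + (2 * r * sin b) ^+ 2 =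
          (1 - 2 * r * cos b + r ^+ 2) * (1 + 2 * r * cos b + r ^+ 2).
  by rewrite [X in _ + X]exprMn s2; ring.
rewrite /disc_ln /disc_arg /disc_ln_dr /disc_arg_dr /disc_norm2.
have atanE : (1 + (2 * r * sin b / (1 - r ^+ 2)) ^+ 2)^-1 =
    (1 - r ^+ 2) ^+ 2 /
      ((1 - 2 * r * cos b + r ^+ 2) * (1 + 2 * r * cos b + r ^+ 2)).
  rewrite -D0; field; rewrite Cn0 /= D0 mulf_neq0//.
split; apply: is_derive_eq; rewrite /GRing.scale/= ?atanE.
- by field; rewrite ?An0 ?Bn0 ?Cn0.
- by field; rewrite ?An0 ?Bn0 ?Cn0.
- by field; rewrite ?An0 ?Bn0 ?Cn0.
- by field; rewrite ?An0 ?Bn0 ?Cn0.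
Qed.

(** [disc_pow_re - i * disc_pow_im] is z^theta at z = (1 - w) / (1 + w), through the principal
    logarithm. *)
Definition disc_pow_re (R : realType) (theta r b : R) : R :=
  expR (theta * disc_ln r b) * cos (theta * disc_arg r b).

Definition disc_pow_im (R : realType) (theta r b : R) : R :=
  expR (theta * disc_ln r b) * sin (theta * disc_arg r b).

Definition disc_pow_re_dr (R : realType) (theta r b : R) : R :=
  expR (theta * disc_ln r b) *
  (theta * disc_ln_dr r b * cos (theta * disc_arg r b)
   - theta * disc_arg_dr r b * sin (theta * disc_arg r b)).

Definition disc_pow_im_dr (R : realType) (theta r b : R) : R :=
  expR (theta * disc_ln r b) *
  (theta * disc_ln_dr r b * sin (theta * disc_arg r b)
   + theta * disc_arg_dr r b * cos (theta * disc_arg r b)).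

(* [disc_re - i * disc_im] is [exp (- c ((1 - w) / (1 + w))^theta)] at
   [w = r exp (i b)]. *)
Definition disc_re (R : realType) (theta c r b : R) : R :=
  expR (- c * disc_pow_re theta r b) * cos (- c * disc_pow_im theta r b).

Definition disc_im (R : realType) (theta c r b : R) : R :=
  expR (- c * disc_pow_re theta r b) * sin (- c * disc_pow_im theta r b).

Definition disc_re_dr (R : realType) (theta c r b : R) : R :=
  expR (- c * disc_pow_re theta r b) *
  (- c * disc_pow_re_dr theta r b * cos (- c * disc_pow_im theta r b)
   - - c * disc_pow_im_dr theta r b * sin (- c * disc_pow_im theta r b)).

Lemma polar_CR_disc_re (R : realType) (theta c r : R) : 0 <= r < 1 ->
  exists dim, polar_CR (disc_re theta c) (disc_im theta c)
    (disc_re_dr theta c) dim r.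
Proof.
move=> r01; eexists; apply: polar_CR_exp; apply: polar_CR_scale.
by apply: polar_CR_exp; apply: polar_CR_scale; exact: polar_CR_disc.
Qed.

(** The Cayley transform has its argument in [-pi/2, pi/2], and multiplying that argument by [theta]
    in [0, 1] keeps it there. *)
Lemma disc_pow_re_ge0 (R : realType) (theta r b : R) : 0 <= theta <= 1 ->
  0 <= disc_pow_re theta r b.
Proof.
move=> /andP[t0 t1]; rewrite mulr_ge0 ?expR_ge0//.
have h1 : - (pi / 2) <= disc_arg r b := ltW (atan_gtNpi2 _).
have h2 : disc_arg r b <= pi / 2 := ltW (atan_ltpi2 _).
apply: cos_ge0_pihalf; rewrite -ler_norml normrM ger0_norm//.
by rewrite -[leRHS]mul1r ler_pM// ler_norml h1.
Qed.

Lemma disc_re_le1 (R : realType) (theta c r b : R) : 0 <= theta <= 1 ->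
  0 <= c -> `|disc_re theta c r b| <= 1.
Proof.
move=> t01 c0; rewrite normrM -[leRHS]mulr1 ler_pM// ?cos_max//.
rewrite ger0_norm ?expR_ge0// -expR0 ler_expR mulNr oppr_le0 mulr_ge0//.
exact: disc_pow_re_ge0.
Qed.

Lemma normr_rotation_le (R : realDomainType) (e E x X y Y u v : R) :
  0 <= e <= E -> `|x| <= X -> `|y| <= Y -> `|u| <= 1 -> `|v| <= 1 ->
  `|e * (x * u + y * v)| <= E * (X + Y).
Proof.
move=> /andP[e0 eE] xX yY u1 v1; rewrite normrM ger0_norm// ler_pM//.
by rewrite (le_trans (ler_normD _ _))// !normrM lerD// -[leRHS]mulr1 ler_pM.
Qed.

Lemma disc_re_dr_bound (R : realType) (theta c m : R) :
  0 <= theta <= 1 -> 0 <= c -> m < 1 ->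
  exists C, forall r b, 0 <= r <= m -> `|disc_re_dr theta c r b| <= C.
Proof.
move=> t01 c0 m1; have /andP[t0 t1] := t01.
(* [E] bounds the modulus of z^theta, from |1 - w|^2 <= 4 and |1 + w|^2 >= (1 - m)^2; [D] bounds the
   inverse of [disc_norm2], and [G] the radial derivatives of both parts of z^theta. *)
pose E := expR (theta * ((ln 4 - ln ((1 - m) ^+ 2)) / 2)).
pose D := ((1 - m) ^+ 2 * (1 - m) ^+ 2)^-1.
pose G := E * (theta * (2 * D) + theta * (4 * D)).
have m2 : 0 < (1 - m) ^+ 2 by rewrite exprn_gt0// subr_gt0.
exists (1 * (c * G + c * G)) => r b /andP[r0 rm].
have r1 : r < 1 := le_lt_trans rm m1.
have r01 : 0 <= r < 1 by rewrite r0.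
have [/andP[A1 A2] /andP[B1 B2]] := disc_factor_ge b r0.
have [A0 B0] := disc_factor_gt0 b r01.
have rm2 : (1 - m) ^+ 2 <= (1 - r) ^+ 2.
  by rewrite lerXn2r ?nnegrE ?subr_ge0 ?(ltW r1) ?(ltW m1)// lerD2l lerN2.
have r4 : (1 + r) ^+ 2 <= 4.
  have -> : 4 = 2 ^+ 2 :> R by rewrite expr2; ring.
  by rewrite lerXn2r ?nnegrE ?addr_ge0//; lra.
have Ele : expR (theta * disc_ln r b) <= E.
  rewrite ler_expR ler_wpM2l// ler_pM2r// lerB// ler_ln ?posrE//.
    exact: le_trans A2 r4.
  exact: le_trans rm2 B1.
have Dle : `|(disc_norm2 r b)^-1| <= D.
  rewrite normfV ger0_norm; last by rewrite mulr_ge0// ltW.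
  rewrite /D /disc_norm2 lef_pV2 ?posrE; last 2 first.
  - exact: mulr_gt0.
  - exact: mulr_gt0.
  rewrite ler_pM ?(ltW m2)//.
  - exact: le_trans rm2 A1.
  - exact: le_trans rm2 B1.
have rr : 0 <= r ^+ 2 <= 1 by rewrite exprn_ge0// expr_le1// ltW.
have lle : `|disc_ln_dr r b| <= 2 * D.
  rewrite normrM ler_pM// normrN normrM -[leRHS]mulr1 ler_pM//.
    by rewrite normrM -[leRHS]mulr1 ler_pM ?cos_max// ger0_norm.
  by rewrite ler_norml; lra.
have ale : `|disc_arg_dr r b| <= 4 * D.
  rewrite normrM ler_pM// normrM.
  have -> : 4 = 2 * 1 * 2 :> R by ring.
  rewrite ler_pM//.
    by rewrite normrM ler_pM ?sin_max// ger0_norm.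
  by rewrite ler_norml; lra.
have tl : `|theta * disc_ln_dr r b| <= theta * (2 * D).
  by rewrite normrM (ger0_norm t0) ler_wpM2l.
have ta : `|theta * disc_arg_dr r b| <= theta * (4 * D).
  by rewrite normrM (ger0_norm t0) ler_wpM2l.
have e0E : 0 <= expR (theta * disc_ln r b) <= E by rewrite expR_ge0.
have Gre : `|disc_pow_re_dr theta r b| <= G.
  rewrite /disc_pow_re_dr -mulNr.
  by apply: normr_rotation_le; rewrite ?normrN ?cos_max ?sin_max.
have Gim : `|disc_pow_im_dr theta r b| <= G.
  by apply: normr_rotation_le; rewrite ?cos_max ?sin_max.
rewrite /disc_re_dr -!mulNr.
apply: normr_rotation_le; rewrite ?cos_max ?sin_max//.
- rewrite expR_ge0/= -expR0 ler_expR mulNr oppr_le0 mulr_ge0//.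
  exact: disc_pow_re_ge0.
- by rewrite normrM normrN (ger0_norm c0) ler_wpM2l.
- by rewrite !mulNr opprK normrM (ger0_norm c0) ler_wpM2l.
Qed.

Lemma continuous_disc_re_dr (R : realType) (theta c r : R) : 0 <= r < 1 ->
  continuous (disc_re_dr theta c r).
Proof.
move=> r01.
have cln : continuous (disc_ln r).
  move=> b; apply/differentiable_continuous/derivable1_diffP.
  by have [_ _ []] := polar_CR_disc r01 b.
have carg : continuous (disc_arg r).
  move=> b; apply/differentiable_continuous/derivable1_diffP.
  by have [_ _ _ []] := polar_CR_disc r01 b.
have cnorm : continuous (fun b => (disc_norm2 r b)^-1).
  move=> b; apply: cvgV.
    by have [? ?] := disc_factor_gt0 b r01; rewrite mulf_neq0// gt_eqF.
  by rewrite /disc_norm2; continuity.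
have clnr : continuous (disc_ln_dr r).
  by move=> b; rewrite /disc_ln_dr; continuity.
have cargr : continuous (disc_arg_dr r).
  by move=> b; rewrite /disc_arg_dr; continuity.
move=> b; rewrite /disc_re_dr /disc_pow_re /disc_pow_im /disc_pow_re_dr.
rewrite /disc_pow_im_dr; continuity.
Qed.

Lemma disc_im_real (R : realType) (theta c r b : R) : sin b = 0 ->
  disc_im theta c r b = 0.
Proof.
move=> sb0; rewrite /disc_im /disc_pow_im /disc_arg sb0 !(mulr0, mul0r).
by rewrite atan0 !(mulr0, sin0).
Qed.

(** By the Cauchy-Riemann equations the radial derivative of [disc_re] is the b-derivative of -
    [disc_im] / r, which vanishes at b = 0 and b = pi, where w is real. Hence the upper half-circle
    suffices. *)
Lemma is_derive_disc_integral (R : realType) (theta c r : R) :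
  0 <= theta <= 1 -> 0 <= c -> 0 < r < 1 ->
  is_derive r 1
    (fun r => \int[@lebesgue_measure R]_(b in `[0, pi]) disc_re theta c r b) 0.
Proof.
move=> t01 c0 /andP[r0 r1].
pose g (z b : R) := - disc_im theta c z b / z.
have g0 : g r pi - g r 0 = 0.
  by rewrite /g !disc_im_real ?sinpi ?sin0// !(oppr0, mul0r) addr0.
apply: (is_derive_eq _ g0).
(* Radii in ]r/2, (1 + r)/2[ stay away from 0, since [g] divides by the radius, and from 1, where
   the derivative bound degenerates. *)
have hm1 : (1 + r) / 2 < 1 by lra.
have [C leC] := disc_re_dr_bound t01 c0 hm1.
have zr z : z \in `]r / 2, (1 + r) / 2[ -> 0 < z < 1 /\ z <= (1 + r) / 2.
  by rewrite in_itv/= => /andP[? ?]; split; [apply/andP; split|]; lra.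
have CR z : z \in `]r / 2, (1 + r) / 2[ ->
    exists dim, polar_CR (disc_re theta c) (disc_im theta c)
      (disc_re_dr theta c) dim z.
  by move=> /zr[/andP[z0 z1] _]; apply: polar_CR_disc_re; rewrite ltW.
apply: (@is_derive_Rintegral_exact _ (disc_re theta c) (disc_re_dr theta c) g
  (r / 2) ((1 + r) / 2) 0 pi C r (pi_gt0 R)).
- by rewrite in_itv/=; apply/andP; split; lra.
- by move=> z b /CR[dim /(_ b)[]].
- by move=> z b /zr[/andP[/ltW z0 _] zm] _; apply: leC; rewrite z0.
- move=> z /CR[dim CRz]; apply: continuous_subspaceT => b.
  apply/differentiable_continuous/derivable1_diffP.
  by have [_ _ []] := CRz b.
- move=> z /zr[/andP[/ltW z0 z1] _]; apply: continuous_subspaceT.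
  by apply: continuous_disc_re_dr; rewrite z0.
- move=> z /CR[dim CRz]; apply: continuous_subspaceT => b.
  apply/differentiable_continuous/derivable1_diffP.
  have [_ _ _ dQ] := CRz b.
  exact: ex_derive.
- move=> z b /[dup] /zr[/andP[z0 z1] _] /CR[dim /(_ b)[_ _ _ dQ]] _.
  rewrite /g; apply: is_derive_eq; rewrite /GRing.scale/=.
  by field; rewrite gt_eqF.
Qed.

Lemma disc_integral_cst (R : realType) (theta c r1 r2 : R) :
  0 <= theta <= 1 -> 0 <= c -> 0 < r1 < 1 -> 0 < r2 < 1 ->
  \int[@lebesgue_measure R]_(b in `[0, pi]) disc_re theta c r1 b =
  \int[@lebesgue_measure R]_(b in `[0, pi]) disc_re theta c r2 b.
Proof.
move=> t01 c0; wlog r12 : r1 r2 / r1 <= r2.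
  move=> h r1_01 r2_01; have [r12|/ltW r21] := leP r1 r2.
    exact: h.
  by apply/esym; exact: h.
move=> /andP[r10 r11] /andP[r20 r21].
pose M r := \int[@lebesgue_measure R]_(b in `[0, pi]) disc_re theta c r b.
have dM z : r1 <= z <= r2 -> is_derive z 1 M 0.
  move=> /andP[r1z zr2]; apply: is_derive_disc_integral => //.
  by rewrite (lt_le_trans r10)//= (le_lt_trans zr2).
have cM : {within `[r1, r2], continuous M}.
  apply: derivable_within_continuous => z; rewrite in_itv/= => /dM[].
  by [].
rewrite -/(M r1) -/(M r2); apply/eqP; rewrite eq_le; apply/andP; split.
  apply: (@ger0_derive1_ndecr _ M r1 r2) => //.
  - by move=> z /subset_itv_oo_cc; rewrite in_itv/= => /dM[].
  - move=> z /subset_itv_oo_cc; rewrite in_itv/= derive1E => /dM dz.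
    by rewrite derive_val.
apply: (@ler0_derive1_nincr _ M r1 r2) => //.
- by move=> z /subset_itv_oo_cc; rewrite in_itv/= => /dM[].
- move=> z /subset_itv_oo_cc; rewrite in_itv/= derive1E => /dM dz.
  by rewrite derive_val.
Qed.

(* Radial limit of [disc_re] at the boundary point [exp (i b)]. *)
Definition disc_bd (R : realType) (theta c b : R) : R :=
  expR (- c * (expR (theta * disc_ln 1 b) * cos (theta * (pi / 2)))) *
  cos (- c * (expR (theta * disc_ln 1 b) * sin (theta * (pi / 2)))).

Lemma cvg_disc_re (R : realType) (theta c b l k : R) (r_ : nat -> R) :
  disc_ln (r_ n) b @[n --> \oo] --> l ->
  disc_arg (r_ n) b @[n --> \oo] --> k ->
  disc_re theta c (r_ n) b @[n --> \oo] -->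
  expR (- c * (expR (theta * l) * cos (theta * k))) *
  cos (- c * (expR (theta * l) * sin (theta * k))).
Proof.
move=> hl hk; rewrite /disc_re /disc_pow_re /disc_pow_im.
by repeat cont_step; exact: hl || exact: hk.
Qed.

(** Dominated convergence with the constant 1. The endpoints are dropped: at radius 1 they are the
    zero and the pole of the Cayley transform. *)
Lemma cvg_disc_integral (R : realType) (theta c : R) (r_ : nat -> R)
    (F : R -> R) :
  0 <= theta <= 1 -> 0 <= c -> (forall n, 0 < r_ n < 1) ->
  (forall b, 0 < b < pi -> disc_re theta c (r_ n) b @[n --> \oo] --> F b) ->
  \int[@lebesgue_measure R]_(b in `[0, pi]) disc_re theta c (r_ n) b
    @[n --> \oo] --> \int[@lebesgue_measure R]_(b in `]0, pi[) F b.
Proof.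
move=> t01 c0 r01 rF.
have cre r : 0 < r < 1 -> continuous (disc_re theta c r).
  move=> /andP[/ltW r0 r1] b.
  have r01' : 0 <= r < 1 by rewrite r0.
  have [dim /(_ b)[_ _ h _]] := polar_CR_disc_re theta c r01'.
  by apply/differentiable_continuous/derivable1_diffP.
have mre r : 0 < r < 1 -> measurable_fun [set: R] (disc_re theta c r).
  by move=> r1; apply: continuous_measurable_fun; exact: cre.
have int1 : (@lebesgue_measure R).-integrable `[0, pi] (EFin \o cst 1).
  apply: continuous_compact_integrable; first exact: segment_compact.
  by apply: continuous_subspaceT; exact: cst_continuous.
have intre n : (@lebesgue_measure R).-integrable `[0, pi]
    (EFin \o disc_re theta c (r_ n)).
  apply: continuous_compact_integrable; first exact: segment_compact.
  by apply: continuous_subspaceT; exact: cre.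
have intS (f : R -> R) (i : interval R) : [set` i] `<=` `[0, pi] ->
    (@lebesgue_measure R).-integrable `[0, pi] (EFin \o f) ->
    (@lebesgue_measure R).-integrable [set` i] (EFin \o f).
  by move=> sub; apply: integrableS.
have closedE n : \int[@lebesgue_measure R]_(b in `[0, pi])
      disc_re theta c (r_ n) b =
    \int[@lebesgue_measure R]_(b in `]0, pi[) disc_re theta c (r_ n) b.
  rewrite -Rintegral_itv_obnd_cbnd; last first.
    by apply: intS => //; exact: subset_itv_oc_cc.
  rewrite -Rintegral_itv_bndo_bndc//.
  by apply: intS => //; exact: subset_itv_oo_cc.
under eq_fun do rewrite closedE.
pose f_ n b := (disc_re theta c (r_ n) b)%:E.
have mf_ n : measurable_fun (`]0, pi[%classic : set R) (f_ n).
  by apply/measurable_EFinP; apply: measurable_funTS; exact: mre.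
have f_F b : (`]0, pi[%classic : set R) b ->
    f_ n b @[n --> \oo] --> (F b)%:E.
  rewrite /= in_itv/= => b0; apply: cvg_EFin; last exact: rF.
  exact: nearW.
have [||||||intF _ cvgF] := @dominated_convergence _ _ R (@lebesgue_measure R)
  (`]0, pi[%classic : set R) _ f_ (EFin \o F) (EFin \o cst 1).
- by [].
- exact: mf_.
- exact: emeasurable_fun_cvg f_F.
- exact: aeW.
- by apply: intS => //; exact: subset_itv_oo_cc.
- by apply: aeW => b n _; rewrite lee_fin disc_re_le1.
apply: fine_cvg; rewrite fineK; last exact: integrable_fin_num.
exact: cvgF.
Qed.

(** The half-circle integral does not depend on the radius: radii tending to 0 give pi times the
    value at z = 1, and radii tending to 1 give the boundary integral. *)
Lemma integral_disc_bd (R : realType) (theta c : R) :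
  0 <= theta <= 1 -> 0 <= c ->
  \int[@lebesgue_measure R]_(b in `]0, pi[) disc_bd theta c b = pi * expR (- c).
Proof.
move=> t01 c0.
pose J (r : R) := \int[@lebesgue_measure R]_(b in `[0, pi]) disc_re theta c r b.
(* The factor 1/2 puts both [e n] and [1 - e n] in ]0, 1[, even for n = 0. *)
pose e (n : nat) : R := 2^-1 * n.+1%:R^-1.
have e0 n : 0 < e n by rewrite mulr_gt0.
have e2 n : e n <= 2^-1.
  by rewrite -[leRHS]mulr1 ler_wpM2l// invf_le1// ler1n.
have ecvg : e n @[n --> \oo] --> 0.
  by rewrite -(mulr0 2^-1); apply: cvgM; [exact: cvg_cst|exact: cvg_harmonic].
have e01 n : 0 < e n < 1 by rewrite e0/= (le_lt_trans (e2 n))//; lra.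
have f01 n : 0 < 1 - e n < 1 by have := e01 n; lra.
have h01 : 0 < (2^-1 : R) < 1 by lra.
have JcstE (r : R) : 0 < r < 1 -> J r = J 2^-1.
  by move=> r01; exact: disc_integral_cst.
have J0 : J 2^-1 = pi * expR (- c).
  have cvgJ : J (e n) @[n --> \oo] -->
      \int[@lebesgue_measure R]_(b in `]0, pi[) (cst (expR (- c)) b).
    apply: cvg_disc_integral => // b _.
    have z01 : 0 <= (0 : R) < 1 by rewrite lexx ltr01.
    have [dl da _ _] := polar_CR_disc z01 b.
    have hl : disc_ln (e n) b @[n --> \oo] --> 0.
      have -> : 0 = disc_ln 0 b :> R.
        by rewrite /disc_ln mulr0 mul0r subr0 addr0 subrr mul0r.
      apply: (@continuous_cvg _ _ _ _ _ _ ((@disc_ln R)^~ b) _ _ ecvg).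
      exact/differentiable_continuous/derivable1_diffP.
    have ha : disc_arg (e n) b @[n --> \oo] --> 0.
      have -> : 0 = disc_arg 0 b :> R.
        by rewrite /disc_arg mulr0 !mul0r atan0.
      apply: (@continuous_cvg _ _ _ _ _ _ ((@disc_arg R)^~ b) _ _ ecvg).
      exact/differentiable_continuous/derivable1_diffP.
    have := @cvg_disc_re _ theta c _ _ _ _ hl ha.
    by rewrite !mulr0 expR0 cos0 sin0 !mulr0 cos0 !mulr1.
  have : J (e n) @[n --> \oo] --> J 2^-1.
    by under eq_fun do rewrite JcstE//; exact: cvg_cst.
  move=> /(cvg_unique _ cvgJ) <-//.
  rewrite Rintegral_cst//=.
  rewrite lebesgue_measure_itv/= lte_fin pi_gt0.
  by rewrite -EFinB subr0/= mulrC.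
rewrite -J0; apply/esym.
have : J (1 - e n) @[n --> \oo] --> J 2^-1.
  by under eq_fun do rewrite JcstE//; exact: cvg_cst.
move=> cvgJ; apply: (cvg_unique _ cvgJ) => //.
apply: cvg_disc_integral => // b /andP[b0 bpi].
have sb : 0 < sin b by rewrite sin_gt0_pi// b0.
have [c1 cN1] : -1 < cos b /\ cos b < 1.
  have : cos b * cos b < 1.
    by rewrite -expr2 cos2sin2 ltrBlDr ltrDl exprn_gt0.
  by split; nra.
have ecvg1 : 1 - e n @[n --> \oo] --> (1 : R).
  by rewrite -[X in _ --> X]subr0; apply: cvgB => //; exact: cvg_cst.
apply: cvg_disc_re.
- rewrite /disc_ln; apply: cvgM; last exact: cvg_cst.
  have cvg_lin k : 1 + k * (1 - e n) * cos b + (1 - e n) ^+ 2 @[n --> \oo] -->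
      1 + k * 1 * cos b + 1 ^+ 2.
    under eq_fun do rewrite expr2.
    by rewrite expr2; repeat cont_step; exact: ecvg1.
  apply: cvgB.
    apply: (@continuous_cvg _ _ _ _ _ _ (@ln R)).
      by apply: continuous_ln; rewrite mulr1 expr1n; lra.
    by have := cvg_lin (- 2); under eq_fun do rewrite !mulNr; rewrite !mulNr.
  apply: (@continuous_cvg _ _ _ _ _ _ (@ln R)); last exact: cvg_lin.
  by apply: continuous_ln; rewrite mulr1 expr1n; lra.
(* At r = 1 - [e n], 1 - r^2 = [e n] (2 - [e n]); as (n + 1) [e n] = 1/2, the argument of [atan] is
   at least (n + 1) sin b. *)
- apply: (@cvg_comp _ _ _ _ (@atan R) _ +oo); last exact: cvgy_atan.
  apply/cvgryPge => A; near=> n.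
  have : A <= sin b * n.+1%:R.
    rewrite -ler_pdivrMl// mulrC (@le_trans _ _ n%:R)//; last by rewrite ler_nat.
    by near: n; exact: nbhs_infty_ger.
  move=> /le_trans; apply.
  have en := e0 n; have en2 := e2 n.
  have ne : n.+1%:R * e n = 2^-1 by rewrite /e mulrCA mulfV ?mulr1 ?pnatr_eq0.
  have den : 0 < 1 - (1 - e n) ^+ 2 by rewrite expr2; nra.
  rewrite ler_pdivlMr//.
  have -> : sin b * n.+1%:R * (1 - (1 - e n) ^+ 2) =
      sin b * (n.+1%:R * e n) * (2 - e n) by ring.
  rewrite ne; nra.
Unshelve. all: by end_near. Qed.

(** * Laplace transform from boundary values *)

Lemma measurable_disc_ln (R : realType) (r : R) :
  measurable_fun [set: R] (disc_ln r).
Proof.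
rewrite /disc_ln; apply: measurable_funM => //.
apply: measurable_funB; apply: measurableT_comp => //;
  by apply: continuous_measurable_fun => b; continuity.
Qed.

Lemma integrable_disc_bd (R : realType) (theta c : R) :
  0 <= theta <= 1 -> 0 <= c ->
  (@lebesgue_measure R).-integrable `]0, pi[ (EFin \o disc_bd theta c).
Proof.
move=> /andP[t0 t1] c0.
have int1 : (@lebesgue_measure R).-integrable `]0, pi[ (EFin \o cst 1).
  have : (@lebesgue_measure R).-integrable `[0, pi] (EFin \o cst 1).
    apply: continuous_compact_integrable; first exact: segment_compact.
    by apply: continuous_subspaceT; exact: cst_continuous.
  by apply: integrableS => //; exact: subset_itv_oo_cc.
have mln := @measurable_disc_ln R 1.
apply: le_integrable int1 => //.
  apply/measurable_EFinP/measurable_funTS; rewrite /disc_bd.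
  have mexp : measurable_fun [set: R] (fun b => expR (theta * disc_ln 1 b)).
    by apply: measurableT_comp => //; exact: measurable_funM.
  apply: measurable_funM.
    apply: measurableT_comp => //.
    by apply: measurable_funM => //; exact: measurable_funM.
  apply: measurableT_comp.
    by apply: continuous_measurable_fun; exact: continuous_cos.
  by apply: measurable_funM => //; exact: measurable_funM.
move=> b _ /=; rewrite lee_fin normr1 normrM -[leRHS]mulr1 ler_pM// ?cos_max//.
rewrite ger0_norm ?expR_ge0// -[leRHS]expR0 ler_expR mulNr oppr_le0 mulr_ge0//.
rewrite mulr_ge0 ?expR_ge0// cos_ge0_pihalf//.
have p0 := pi_gt0 R; apply/andP; split; first by nra.
by rewrite -[leRHS]mul1r ler_wpM2r// divr_ge0// pi_ge0.
Qed.

(** As exp ([disc_ln 1 b]) = tan (b / 2), taking b uniform averages against the half-Cauchy law: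
    this is the Poisson formula at z = 1. *)
Lemma mean_disc_bd (R : realType) (theta c : R) :
  0 <= theta <= 1 -> 0 <= c ->
  (\int[@lebesgue_measure R]_(b in `]0%R, pi[) (pi^-1 * disc_bd theta c b)%:E =
   (expR (- c))%:E)%E.
Proof.
move=> t01 c0; have ibd := integrable_disc_bd t01 c0.
under eq_integral do rewrite EFinM.
rewrite integralZl//= -[X in (_ * X)%E]fineK; last exact: integrable_fin_num.
rewrite -/(Rintegral _ _ _) integral_disc_bd// -EFinM mulrA mulVf ?mul1r//.
by rewrite gt_eqF// pi_gt0.
Qed.

(** The averaging formula is used twice. With exponent 1 and constant lam X >= 0 it writes exp (-
    lam X) as a mean of cosines; after Fubini the inner expectation is the given one, and the
    formula with exponent [theta] and constant t lam^theta evaluates the mean. *)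
Lemma laplace_of_char_fun (d : measure_display) (T : measurableType d)
    (R : realType) (P : probability T R) (X : {RV P >-> R}) (theta t lam : R) :
  0 <= theta <= 1 -> 0 <= t -> 0 < lam ->
  {ae P, forall w, 0 <= X w} ->
  (forall g, 0 < g -> \int[P]_w cos (g * X w) =
     expR (- (t * g `^ theta * cos (theta * (pi / 2)))) *
     cos (t * g `^ theta * sin (theta * (pi / 2)))) ->
  (\int[P]_w (expR (- (lam * X w)))%:E = (expR (- (t * lam `^ theta)))%:E)%E.
Proof.
move=> t01 t0 lam0 X0 hX.
pose g (b : R) : R := lam * expR (disc_ln 1 b).
have g0 b : 0 < g b by rewrite mulr_gt0// expR_gt0.
have mln := @measurable_disc_ln R 1.
have mg : measurable_fun [set: R] g.
  by apply: measurable_funM => //; exact: measurableT_comp.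
pose F (z : T * R) : \bar R :=
  (pi^-1 * cos (g z.2 * X z.1) * \1_(`]0, pi[%classic : set R) z.2)%:E.
have mF : measurable_fun [set: T * R] F.
  apply/measurable_EFinP; apply: measurable_funM; last first.
    by apply: measurableT_comp => //; exact: measurable_indic.
  apply: measurable_funM => //; apply: measurableT_comp.
    by apply: continuous_measurable_fun; exact: continuous_cos.
  apply: measurable_funM; first exact: measurableT_comp.
  exact: measurableT_comp.
have Fint (f : R -> R) :
    (\int[@lebesgue_measure R]_b
       (f b * \1_(`]0, pi[%classic : set R) b)%:E =
     \int[@lebesgue_measure R]_(b in `]0%R, pi[) (f b)%:E)%E.
  rewrite [RHS]integral_mkcond; apply: eq_integral => b _.
  by rewrite patchE indicE; case: ifPn => _; rewrite ?mulr1 ?mulr0.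
have mFw w : measurable_fun [set: R] (fun b => F (w, b)) by exact: measurableT_comp.
have Fw_le1 w : (\int[@lebesgue_measure R]_b `|F (w, b)| <= 1)%E.
  (* [disc_bd 0 0] is identically 1, so its normalized mean dominates that of the cosine. *)
  have -> : 1%E = (\int[@lebesgue_measure R]_b
      (pi^-1 * disc_bd 0 0 b * \1_(`]0, pi[%classic : set R) b)%:E)%E.
    by rewrite Fint mean_disc_bd ?lexx ?ler01// oppr0 expR0.
  apply: ge0_le_integral => //.
  - by apply: measurableT_comp => //; exact: mFw.
  - apply/measurable_EFinP; apply: measurable_funM => //.
    apply: measurable_funM => //; rewrite /disc_bd oppr0.
    under eq_fun do rewrite !mul0r expR0 cos0 mul1r.
    exact: measurable_cst.
  - move=> b _; rewrite /F /= lee_fin !normrM (ger0_norm (_ : 0 <= \1_ _ b))//.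
    rewrite ler_wpM2r// ger0_norm ?invr_ge0 ?pi_ge0// ler_wpM2l ?invr_ge0 ?pi_ge0//.
    by rewrite /disc_bd oppr0 !mul0r expR0 cos0 mul1r cos_max.
have intF : (P \x (@lebesgue_measure R))%E.-integrable [set: T * R] F.
  apply/integrable12ltyP => //; apply: (@le_lt_trans _ _ (\int[P]_w 1)%E).
    apply: ge0_le_integral => //.
    - by move=> w _; exact: integral_ge0.
    - apply: (@measurable_fun_fubini_tonelli_F _ _ _ _ _ (@lebesgue_measure R)
        (abse \o F)) => [|z]; last exact: abse_ge0.
      exact: measurableT_comp.
  by rewrite integral_cst//= probability_setT mule1 ltry.
have := Fubini intF.
have -> : (\int[P]_w \int[@lebesgue_measure R]_b F (w, b) =
           \int[P]_w (expR (- (lam * X w)))%:E)%E.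
  apply: ae_eq_integral => //.
  - exact: (measurable_fubini_F intF).
  - by apply/measurable_EFinP; apply: measurableT_comp => //;
      apply: measurableT_comp => //; exact: measurable_funM.
  - apply: filterS X0 => w Xw0 _.
    rewrite Fint -(@mean_disc_bd _ 1) ?ler01 ?lexx ?mulr_ge0 ?(ltW lam0)//.
    apply: eq_integral => b _; congr (_ * _)%:E; rewrite /disc_bd.
    rewrite !mul1r cos_pihalf sin_pihalf !mulr0 expR0 mul1r mulr1.
    by rewrite mulNr cosN /g; congr cos; ring.
move=> ->.
rewrite -(@mean_disc_bd _ theta) ?mulr_ge0 ?powR_ge0// -Fint.
apply: eq_integral => b _.
transitivity (\int[P]_w ((pi^-1 * \1_(`]0, pi[%classic : set R) b)%:E *
    (cos (g b * X w))%:E))%E.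
  by apply: eq_integral => w _; rewrite /F/= -EFinM; congr EFin; ring.
have icos : P.-integrable [set: T] (fun w => (cos (g b * X w))%:E).
  apply: le_integrable (finite_measure_integrable_cst P 1 measurableT) => //.
    apply/measurable_EFinP; apply: measurableT_comp.
      by apply: continuous_measurable_fun; exact: continuous_cos.
    exact: measurable_funM.
  by move=> w _ /=; rewrite lee_fin normr1 cos_max.
rewrite integralZl//= -[X in (_ * X)%E]fineK; last exact: integrable_fin_num.
rewrite -/(Rintegral _ _ _) hX// -EFinM; congr EFin.
rewrite mulrAC; congr (_ * _ * _); rewrite /disc_bd.
have -> : g b `^ theta = lam `^ theta * expR (theta * disc_ln 1 b).
  rewrite powRM ?expR_ge0 ?(ltW lam0)//; congr (_ * _).
  by rewrite /powR gt_eqF ?expR_gt0// expRK.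
by rewrite !mulNr cosN !mulrA.
Qed.

(** * Subordination *)

(* Real part of [exp (i phi) exp (i x y exp (i phi))]. *)
Definition rotated_cos (R : realType) (phi x y : R) : R :=
  expR (- (x * (y * sin phi))) * cos (phi + x * (y * cos phi)).

(** Imaginary part of exp (i x y exp (i phi)). *)
Definition rotated_sin (R : realType) (phi x y : R) : R :=
  expR (- (x * (y * sin phi))) * sin (x * (y * cos phi)).

Lemma expR_rotated_le (R : realType) (phi x y : R) : 0 <= y ->
  expR (- (x * (y * sin phi))) <= expR (`|x| * y).
Proof.
move=> y0; rewrite ler_expR (le_trans (ler_norm _))// normrN !normrM.
by rewrite ler_wpM2l// ger0_norm// -[leRHS]mulr1 ler_wpM2l// sin_max.
Qed.

Lemma integrable_rotated_cos (R : realType) (phi x t p : R) :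
  0 < t -> 1 < p ->
  (@lebesgue_measure R).-integrable `[0, +oo[
    (EFin \o (fun y => rotated_cos phi x y * expR (- (t * y `^ p)))).
Proof.
move=> t0 p1; apply: (@integrable_le_expR_powR _ 1 `|x| t p) => //.
  apply: measurable_funTS; apply: measurable_funM.
    by apply: continuous_measurable_fun => y; rewrite /rotated_cos; continuity.
  apply: measurableT_comp => //; apply: measurableT_comp => //.
  by apply: measurable_funM => //; exact: measurable_powR.
move=> y y0; rewrite mul1r expRD normrM (ger0_norm (expR_ge0 _)) ler_wpM2r//.
rewrite normrM -[leRHS]mulr1 ler_pM// ?cos_max// ger0_norm ?expR_ge0//.
exact: expR_rotated_le.
Qed.

Lemma integrable_rotated_sin (R : realType) (phi x t p : R) :
  0 < t -> 1 < p ->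
  (@lebesgue_measure R).-integrable `[0, +oo[
    (EFin \o (fun y => rotated_sin phi x y * gen_gamma_pdf p (1 / t) y)).
Proof.
move=> t0 p1.
(* The density brings in p t y^(p - 1), and y^(p - 1) <= exp ((p - 1) y). *)
apply: (@integrable_le_expR_powR _ (p * t) (`|x| + (p - 1)) t p) => //.
  apply: measurable_funTS; apply: measurable_funM.
    by apply: continuous_measurable_fun => y; rewrite /rotated_sin; continuity.
  rewrite /gen_gamma_pdf; apply: measurable_funM.
    by apply: measurable_funM => //; apply: measurable_funM => //;
      exact: measurable_powR.
  apply: measurableT_comp => //; apply: measurableT_comp => //.
  by apply: measurable_funM => //; exact: measurable_powR.
move=> y y0; have p0 : 0 < p by rewrite (lt_trans _ p1).
rewrite /gen_gamma_pdf div1r !invrK mulrDl -addrA !expRD.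
have -> : rotated_sin phi x y * (p * (y `^ (p - 1) * t) * expR (- (y `^ p * t)))
    = p * t * (rotated_sin phi x y * (y `^ (p - 1) * expR (- (t * y `^ p)))).
  by rewrite [y `^ p * t]mulrC; ring.
rewrite normrM (ger0_norm (_ : 0 <= p * t)) ?mulr_ge0 ?(ltW p0) ?(ltW t0)//.
rewrite ler_wpM2l ?mulr_ge0 ?(ltW p0) ?(ltW t0)//.
rewrite normrM ler_pM//.
  rewrite normrM -[leRHS]mulr1 ler_pM// ?sin_max// ger0_norm ?expR_ge0//.
  exact: expR_rotated_le.
rewrite normrM (ger0_norm (expR_ge0 _)) ler_wpM2r ?expR_ge0//.
(* At y = 0 the power is 0, its exponent being nonzero; otherwise ln y <= y. *)
rewrite ger0_norm ?powR_ge0// /powR; case: ifPn => [_|yn0].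
  by rewrite subr_eq0 (gt_eqF p1)/= expR_ge0.
rewrite ler_expR ler_wpM2l ?subr_ge0 ?(ltW p1)//.
have := expR_ge1Dx (ln y); rewrite lnK ?posrE ?lt_def ?yn0//; lra.
Qed.

(* Integration by parts against [exp (- t y^p)]: [rotated_cos] is the
   derivative of [rotated_sin / x]. *)
Lemma integral_rotated_cos (R : realType) (phi x t p : R) :
  0 < t -> 1 < p ->
  x * \int[@lebesgue_measure R]_(y in `[0, +oo[)
        (rotated_cos phi x y * expR (- (t * y `^ p))) =
  \int[@lebesgue_measure R]_(y in `[0, +oo[)
    (rotated_sin phi x y * gen_gamma_pdf p (1 / t) y).
Proof.
move=> t0 p1; have p0 : 0 < p by rewrite (lt_trans _ p1).
have p10 : 0 < p - 1 by rewrite subr_gt0.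
have intc := integrable_rotated_cos phi x t0 p1.
have ints := integrable_rotated_sin phi x t0 p1.
have intxc : (@lebesgue_measure R).-integrable `[0, +oo[
    (EFin \o (fun y => x * (rotated_cos phi x y * expR (- (t * y `^ p))))).
  exact: (integrableZl _ x intc).
apply/eqP; rewrite -subr_eq0 -RintegralZl// -RintegralB//; apply/eqP.
set f := (fun y : R => _ - _).
have intf : (@lebesgue_measure R).-integrable `[0, +oo[ (EFin \o f).
  exact: (integrableB _ intxc ints).
apply: (cvg_unique _ (cvg_Rintegral_itv0y intf)) => //.
(* A primitive of the difference of the two integrands on y > 0. It vanishes at 0 through the sine,
   and at infinity because t N^p outgrows |x| N. *)
pose HE (y : R) := rotated_sin phi x y * expR (- (t * `|y| `^ p)).
pose f1 (y : R) := x * (rotated_cos phi x y * expR (- (t * `|y| `^ p)))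
  - rotated_sin phi x y * (p * (`|y| `^ (p - 1) * t) * expR (- (t * `|y| `^ p))).
have cHE : continuous HE.
  by move=> y; rewrite /HE /rotated_sin; continuity.
have cf1 : continuous f1.
  by move=> y; rewrite /f1 /rotated_sin /rotated_cos; continuity.
have fE y : 0 <= y -> f y = f1 y.
  move=> y0; rewrite /f /f1 /gen_gamma_pdf div1r !invrK ger0_norm//.
  by rewrite [y `^ p * t]mulrC.
have dHE (y : R) : 0 < y -> is_derive y 1 HE (f1 y).
  move=> y0.
  have nyE : \near y, y `^ p = `|y| `^ p.
    near=> z; rewrite ger0_norm//.
    by apply: ltW; near: z; exact: lt_nbhsr.
  have dw : is_derive y 1 (fun y => `|y| `^ p) (p * y `^ (p - 1)).
    by apply: near_eq_is_derive nyE _; exact: is_derive1_powR.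
  rewrite /HE /f1 /rotated_sin /rotated_cos.
  apply: is_derive_eq; rewrite /GRing.scale/= gtr0_norm// cosD.
  ring.
have HEN N : 0 < N ->
    \int[@lebesgue_measure R]_(y in `[0, N]) f y = HE N.
  move=> N0.
  have -> : HE N = HE N - HE 0.
    by rewrite {3}/HE /rotated_sin !(mul0r, mulr0) sin0 mulr0 mul0r subr0.
  rewrite /Rintegral; under eq_integral => y.
    rewrite inE/= in_itv/= => /andP[y0 _]; rewrite fE//; over.
  rewrite (@continuous_FTC2 _ _ HE)//.
  - exact: continuous_subspaceT.
  - have := @continuous_subspaceT _ _ `[0, N] _ cHE.
    move=> /(continuous_within_itvP _ N0)[_ H0 HN].
    split; [move=> y; rewrite in_itv/= => /andP[y0 _]|exact: H0|exact: HN].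
    by case: (dHE y y0).
  - by move=> y; rewrite in_itv/= derive1E => /andP[/dHE[_ <-]].
apply: (cvg_trans (_ : _ --> (HE @ +oo))).
  by apply: near_eq_cvg; near=> N; rewrite HEN.
have [C leC] := linear_sub_powR_le `|x| t0 p1.
have bound0 : expR C * expR (- N) @[N --> +oo] --> (0 : R).
  rewrite -(mulr0 (expR C)).
  by apply: cvgM; [exact: cvg_cst|exact: cvgr_expR].
apply/cvgr0Pnorm_le => e e0; near=> N.
have N0 : 0 <= N by [].
apply: (@le_trans _ _ `|expR C * expR (- N)|); last first.
  by near: N; exact: cvgr0_norm_le.
rewrite [leRHS]ger0_norm ?mulr_ge0 ?expR_ge0//.
rewrite /HE normrM (ger0_norm (expR_ge0 _)) (ger0_norm N0).
rewrite -expRD (@le_trans _ _ (expR (`|x| * N - t * N `^ p)))//.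
  rewrite expRD ler_wpM2r ?expR_ge0// normrM -[leRHS]mulr1.
  rewrite ler_pM// ?sin_max// ger0_norm ?expR_ge0//.
  exact: expR_rotated_le.
by rewrite ler_expR leC.
Unshelve. all: by end_near. Qed.

(** * Averaging over the law of the subordinator *)

Lemma integral_RV (d : measure_display) (T : measurableType d) (R : realType)
    (P : probability T R) (X : {RV P >-> R}) (g : R -> R) :
  measurable_fun [set: R] g ->
  (\int[distribution P X]_y (g y)%:E = \int[P]_w (g (X w))%:E)%E.
Proof.
move=> mg; have mEg : measurable_fun [set: R] (EFin \o g).
  exact/measurable_EFinP.
rewrite integralE [RHS]integralE !ge0_integral_distribution//; last 2 first.
- exact: measurable_funeneg.
- exact: measurable_funepos.
by congr (_ - _)%E; apply: eq_integral => w _; rewrite /= ?funeposE ?funenegE.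
Qed.

Lemma integral_indic_itv0y (R : realType) (f : R -> R) :
  (\int[@lebesgue_measure R]_y (f y * \1_(`]0, +oo[%classic : set R) y)%:E =
   \int[@lebesgue_measure R]_(y in `]0%R, +oo[) (f y)%:E)%E.
Proof.
rewrite [RHS]integral_mkcond; apply: eq_integral => y _.
by rewrite patchE indicE; case: ifPn => _; rewrite ?mulr1 ?mulr0.
Qed.

(** Fubini, the Laplace transform of [mu] at y^alpha being a hypothesis. The indicator restricts to
    s > 0, where exp (- s y^alpha) makes the inner integral absolutely convergent. *)
Lemma integral_mixture (R : realType) (mu : probability R R)
    (phi x t p alpha : R) (v : R -> R) :
  0 < t -> 1 < p -> 1 < alpha ->
  (forall y, 0 < y ->
    (\int[mu]_s (expR (- (s * y `^ alpha)) *
       \1_(`]0, +oo[%classic : set R) s)%:E = (expR (- (t * y `^ p)))%:E)%E) ->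
  (forall s, v s = \int[@lebesgue_measure R]_(y in `[0, +oo[)
     (rotated_cos phi x y * expR (- (s * y `^ alpha))) *
     \1_(`]0, +oo[%classic : set R) s) ->
  mu.-integrable [set: R] (EFin \o v) /\
  (\int[mu]_s (v s)%:E =
   (\int[@lebesgue_measure R]_(y in `[0%R, +oo[)
     (rotated_cos phi x y * expR (- (t * y `^ p))))%:E)%E.
Proof.
move=> t0 p1 al1 hmu vE.
pose K := rotated_cos phi x.
pose I := \1_(`]0, +oo[%classic : set R) : R -> R.
have I0 y : y <= 0 -> I y = 0.
  by move=> y0; rewrite /I indicE memNset//= in_itv/= andbT; apply/negP; rewrite -leNgt.
have I1 y : 0 < y -> I y = 1.
  by move=> y0; rewrite /I indicE mem_set//= in_itv/= andbT.
have Ige0 y : 0 <= I y by [].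
have mI : measurable_fun [set: R] I by exact: measurable_indic.
have mK : measurable_fun [set: R] K.
  by apply: continuous_measurable_fun => y; rewrite /K /rotated_cos; continuity.
pose e (s y : R) := expR (- (s * y `^ alpha)) * I s.
have e0 s y : 0 <= e s y by rewrite mulr_ge0 ?expR_ge0.
pose F (z : R * R) : \bar R := (K z.2 * I z.2 * e z.1 z.2)%:E.
have me : measurable_fun [set: R * R] (fun z : R * R => e z.1 z.2).
  apply: measurable_funM; last exact: measurableT_comp.
  apply: measurableT_comp => //; apply: measurableT_comp => //.
  apply: measurable_funM => //.
  by apply: (measurableT_comp (@measurable_powR R alpha)); exact: measurable_snd.
have mF : measurable_fun [set: R * R] F.
  apply/measurable_EFinP; apply: measurable_funM => //.
  by apply: measurable_funM; exact: measurableT_comp.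
have mey y : measurable_fun [set: R] (e ^~ y).
  apply: measurable_funM => //; apply: measurableT_comp => //.
  by apply: measurableT_comp => //; exact: measurable_funM.
have inte y : 0 < y -> mu.-integrable [set: R] (fun s => (e s y)%:E).
  move=> y0; apply/integrableP; split; first exact/measurable_EFinP.
  under eq_integral do rewrite /= ger0_norm//.
  by rewrite hmu// ltry.
have Fy_int y : (\int[mu]_s F (s, y) =
    (K y * expR (- (t * y `^ p)) * I y)%:E)%E.
  have [y0|y0] := leP y 0.
    rewrite (I0 _ y0) mulr0; apply: integral0_eq => s _.
    by rewrite /F/= (I0 _ y0) mulr0 mul0r.
  transitivity (\int[mu]_s ((K y)%:E * (e s y)%:E))%E.
    by apply: eq_integral => s _; rewrite /F/= (I1 _ y0) mulr1.
  by rewrite integralZl ?hmu ?(I1 _ y0) ?mulr1//; exact: inte.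
have Fy_abs y : (\int[mu]_s `|F (s, y)| =
    (`|K y * expR (- (t * y `^ p))| * I y)%:E)%E.
  have [y0|y0] := leP y 0.
    rewrite (I0 _ y0) mulr0; apply: integral0_eq => s _.
    by rewrite /F/= (I0 _ y0) mulr0 mul0r normr0.
  transitivity (\int[mu]_s ((`|K y|)%:E * (e s y)%:E))%E.
    apply: eq_integral => s _.
    by rewrite /F/= (I1 _ y0) mulr1 normrM (ger0_norm (e0 _ _)).
  rewrite integralZl ?hmu ?(I1 _ y0) ?mulr1//; last exact: inte.
  by rewrite -EFinM [in RHS]normrM [`|expR _|]ger0_norm ?expR_ge0.
have sub0 : `]0, +oo[%classic `<=` (`[0, +oo[%classic : set R).
  by move=> y /=; rewrite !in_itv/= !andbT; exact: ltW.
have intKy := integrable_rotated_cos phi x t0 p1.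
have intF : (mu \x (@lebesgue_measure R))%E.-integrable [set: R * R] F.
  (* With s integrated first, the Laplace transform gives the inner integral of the absolute value
     exactly, and p > 1 makes the outer one finite. *)
  apply/integrable21ltyP => //.
  under eq_integral do rewrite Fy_abs.
  rewrite (integral_indic_itv0y (fun y => `|K y * expR (- (t * y `^ p))|)).
  rewrite integral_itv_obnd_cbnd; last first.
    apply: (measurable_funS _ sub0 (measurable_int _ (integrable_abse intKy))).
    by [].
  by case/integrableP : intKy.
have oc (f : R -> R) :
    (@lebesgue_measure R).-integrable `[0, +oo[ (EFin \o f) ->
    (\int[@lebesgue_measure R]_(y in `]0%R, +oo[) (f y)%:E)%E =
    (\int[@lebesgue_measure R]_(y in `[0, +oo[) f y)%:E.
  move=> intf; rewrite /Rintegral fineK; last exact: integrable_fin_num.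
  apply: integral_itv_obnd_cbnd.
  apply: (measurable_funS _ sub0 (measurable_int _ intf)).
  by [].
have vF s : (v s)%:E = (\int[@lebesgue_measure R]_y F (s, y))%E.
  rewrite vE; have [s0|s0] := leP s 0.
    rewrite -/I (I0 _ s0) mulr0; apply/esym/integral0_eq => y _.
    by rewrite /F/= /e (I0 _ s0) !mulr0.
  rewrite -/I (I1 _ s0) mulr1 -oc; last exact: integrable_rotated_cos.
  rewrite -integral_indic_itv0y; apply: eq_integral => y _.
  by rewrite /F/= /e (I1 _ s0) mulr1 mulrAC.
split.
  rewrite (_ : EFin \o v = fun s => (\int[@lebesgue_measure R]_y F (s, y))%E).
    exact: (integrable_fubini_F intF).
  exact/funext.
under eq_integral do rewrite vF.
rewrite (Fubini intF); under eq_integral do rewrite Fy_int.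
by rewrite (integral_indic_itv0y (fun y => K y * expR (- (t * y `^ p)))) oc.
Qed.

Lemma integral_pdf (d : measure_display) (T : measurableType d) (R : realType)
    (P : probability T R) (X : {RV P >-> R}) (D : set R) (f g : R -> R) :
  measurable D -> is_pdf_on D X f -> measurable_fun [set: R] g ->
  (\int[P]_w (g (X w))%:E =
   \int[@lebesgue_measure R]_(y in D) (g y * f y)%:E)%E.
Proof.
move=> mD [mf f0 hf] mg.
exact: (@integral_density _ _ (measurableTypeR R) T R (@lebesgue_measure R) P X
  D f g (measurable_funP X) mD mf f0 hf mg).
Qed.

Lemma char_fun_stable_re (d : measure_display) (T : measurableType d)
    (R : realType) (P : probability T R) (S : R -> {RV P >-> R})
    (theta t g : R) :
  is_stable_subordinator theta S -> 0 <= t -> 0 < g ->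
  \int[P]_w cos (g * S t w) =
  expR (- (t * g `^ theta * cos (theta * (pi / 2)))) *
  cos (t * g `^ theta * sin (theta * (pi / 2))).
Proof.
move=> [_ hchar] t0 g0; have := congr1 (@complex.Re R) (hchar t g t0).
rewrite /char_fun /cexp /= gtr0_sg// gtr0_norm//.
rewrite !(mulr1, mul1r, mul0r, mulr0, subr0, sub0r, addr0, add0r, oppr0,
  expR0, opprK) => ->.
by rewrite !cosN sinN mulrN cosN !mulrA.
Qed.

Lemma laplace_stable (d : measure_display) (T : measurableType d)
    (R : realType) (P : probability T R) (S : R -> {RV P >-> R})
    (f : R -> R) (theta t lam : R) :
  0 < theta -> theta < 1 -> is_stable_subordinator theta S -> 0 <= t ->
  is_pdf_on `]0, +oo[ (S t) f -> 0 < lam ->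
  (\int[distribution P (S t)]_s (expR (- (s * lam)) *
     \1_(`]0, +oo[%classic : set R) s)%:E = (expR (- (t * lam `^ theta)))%:E)%E.
Proof.
move=> th0 th1 hS t0 [mf f0 hf] lam0.
(* A density carried by ]0, +oo[ gives ]-oo, 0] no mass, so the indicator is almost surely 1. *)
have S0 : {ae P, forall w, 0 < S t w}.
  exists (S t @^-1` `]-oo, 0]); split.
  - by rewrite -[X in measurable X]setTI; exact: measurable_funP.
  - have := hf `]-oo, 0]%classic (measurable_itv _).
    rewrite (_ : `]-oo, 0]%classic `&` `]0, +oo[ = set0) ?integral_set0//.
    by rewrite -subset0 => s /=; rewrite !in_itv/= andbT => -[] /le_lt_trans h /h;
      rewrite ltxx.
  - by move=> w /= /negP; rewrite in_itv/= -leNgt.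
rewrite (@integral_RV _ _ _ _ _ (fun s => expR (- (s * lam)) *
     \1_(`]0, +oo[%classic : set R) s)); last first.
  apply: measurable_funM; last exact: measurable_indic.
  by apply: measurableT_comp => //; apply: measurableT_comp => //;
    exact: measurable_funM.
have th01 : 0 <= theta <= 1 by rewrite !ltW.
have S0' : {ae P, forall w, 0 <= S t w} by apply: filterS S0 => w /ltW.
rewrite -(laplace_of_char_fun th01 t0 lam0 S0'); last first.
  by move=> g g0; exact: char_fun_stable_re.
apply: ae_eq_integral => //.
- apply/measurable_EFinP; apply: measurable_funM.
    by apply: measurableT_comp => //; apply: measurableT_comp => //;
      exact: measurable_funM.
  by apply: measurableT_comp => //; exact: measurable_indic.
- apply/measurable_EFinP; apply: measurableT_comp => //.
  by apply: measurableT_comp => //; exact: measurable_funM.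
- apply: filterS S0 => w Sw0 _.
  by rewrite indicE mem_set ?mulr1 1?mulrC//= in_itv/= andbT.
Qed.

Theorem theorem5 (R : realType) (alpha theta : R)
    (halpha : 1 < alpha) (htheta0 : 0 < theta) (htheta1 : theta < 1)
    (d : measure_display) (Omega : measurableType d) (P : probability Omega R)
    (S : R -> {RV P >-> R}) (hS : is_stable_subordinator theta S)
    (h : R -> R -> R)
    (hh : forall t : R, 0 < t -> is_pdf_on `]0, +oo[ (S t) (fun s => h s t))
    (halphatheta : 1 < alpha * theta)
    (t x : R) (ht : 0 < t) (hx : x != 0)
    (d' : measure_display) (Omega' : measurableType d')
    (Q : probability Omega' R) (G : {RV Q >-> R})
    (hG : is_pdf_on `]0, +oo[ G (gen_gamma_pdf (alpha * theta) (1 / t))) :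
  let a := cos (pi / (2 * alpha)) in
  let b := sin (pi / (2 * alpha)) in
  subordinated_pseudo_density alpha h x t
  = ((1 / (pi * x))%:E
     * 'E_Q[(fun w => expR (- b * x * G w) * sin (a * x * G w))%R])%E.
Proof.
move=> a b; set p := alpha * theta; pose phi := pi / (2 * alpha).
have al0 : 0 < alpha by rewrite (lt_trans _ halpha).
have pi0 := pi_gt0 R.
(* For s > 0 this is pi times the pseudo-density, by the rotation formula; elsewhere it is cut to
   0. *)
pose v (s : R) := \int[@lebesgue_measure R]_(y in `[0, +oo[)
     (rotated_cos phi x y * expR (- (s * y `^ alpha))) *
     \1_(`]0, +oo[%classic : set R) s.
have [iv intv] : (distribution P (S t)).-integrable [set: R] (EFin \o v) /\
  (\int[distribution P (S t)]_s (v s)%:E =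
   (\int[@lebesgue_measure R]_(y in `[0%R, +oo[)
     (rotated_cos phi x y * expR (- (t * y `^ p))))%:E)%E.
  apply: (@integral_mixture _ _ _ _ _ _ alpha) => // y y0.
  rewrite (laplace_stable htheta0 htheta1 hS (ltW ht) (hh t ht)) ?powR_gt0//.
  by rewrite -powRrM.
have mv : measurable_fun [set: R] (fun s => pi^-1 * v s).
  apply: measurable_funM => //; apply/measurable_EFinP.
  exact: (measurable_int _ iv).
have subE : subordinated_pseudo_density alpha h x t =
    (\int[distribution P (S t)]_s (pi^-1 * v s)%:E)%E.
  rewrite (integral_RV (S t) mv) (integral_pdf _ (hh t ht) mv)//.
  apply: eq_integral => s; rewrite inE/= in_itv/= andbT => s0.
  congr (_ * _)%:E; rewrite pseudo_densityE//; congr (_ * _).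
  rewrite /v indicE mem_set /= ?in_itv/= ?s0// mulr1.
  apply: eq_Rintegral => y; rewrite inE/= in_itv/= andbT => y0.
  rewrite /ray_integrand ray_exponent_pihalf// ray_phase_pihalf//.
  by rewrite ger0_norm// expRD /rotated_cos mulrAC.
have mg : measurable_fun [set: R]
    (fun y : R => expR (- b * x * y) * sin (a * x * y)).
  by apply: continuous_measurable_fun => y; continuity.
rewrite subE unlock (integral_pdf (measurable_itv _) hG mg).
have p1 : 1 < p by [].
have intsin := integrable_rotated_sin phi x ht p1.
under eq_integral do rewrite EFinM.
rewrite integralZl// intv; apply/esym.
(* Integration by parts turns the sine integral into x times the cosine one; [hx] allows cancelling
   x. *)
rewrite (_ : (\int[_]_(_ in _) _ = (\int[@lebesgue_measure R]_(y in `[0%R, +oo[)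
    (rotated_sin phi x y * gen_gamma_pdf p (1 / t) y))%:E)%E).
  rewrite -(integral_rotated_cos phi x ht p1) -!EFinM; congr EFin.
  by rewrite div1r invfM -mulrA mulKf.
rewrite /Rintegral fineK; last exact: integrable_fin_num.
rewrite -integral_itv_obnd_cbnd; last first.
  apply: (measurable_funS _ _ (measurable_int _ intsin)) => //.
  by move=> y /=; rewrite !in_itv/= !andbT; exact: ltW.
apply: eq_integral => y _; congr (_ * _)%:E.
by rewrite /rotated_sin /a /b -/phi; congr (expR _ * sin _); ring.
Qed.
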